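(* Let $\mathbb K$ be a field of characteristic zero, let $\mathcal A=\mathbb K[x_1,\ldots,x_n]=\mathbb K[\mathbb A^n]$ with $\mathbb A^n\cong\mathbb K^n$ carry a Poisson structure with polynomial Poisson tensor $\pi$ of index $\ell$, and let $\tilde\pi=\lim_{t\to0}\pi_t$ be a contraction of $\pi$ given by a family of linear automorphisms $\varphi_t:(\mathbb K^n)^*\to(\mathbb K^n)^*$ ($t\in\mathbb K^{\times}$) with determinants $\det\varphi_t=t^{D_t}$. Suppose that the index of the Poisson algebra $(\mathcal A,\tilde\pi)$ is also equal to $\ell$. Suppose that $F_1,\ldots,F_\ell\in Z(\mathcal A,\pi)$ satisfy the Kostant equality with $\pi$, i.e. $\frac{dF_1\wedge\ldots\wedge dF_\ell}{\omega}=\Lambda^{(n-\ell)/2}\pi$. Then: (i) $\sum_{i=1}^{\ell}\deg_t F_i\ge D_t$; moreover, if $\sum_{i=1}^{\ell}\deg_t F_i>D_t$, then $F_1^\bullet,\ldots,F_\ell^\bullet$ are algebraically dependent; (ii) if $\sum_{i=1}^{\ell}\deg_t F_i=D_t$, then $F_1^\bullet,\ldots,F_\ell^\bullet$ are algebraically independent and satisfy the Kostant equality with $\tilde\pi$, i.e. $\frac{dF_1^\bullet\wedge\ldots\wedge dF_\ell^\bullet}{\omega}=\Lambda^{(n-\ell)/2}\tilde\pi$; (iii) if $\sum_{i=1}^{\ell}\deg_t F_i=D_t$, $\dim\mathrm{Sing}\,\tilde\pi\le n-2$, and each $F_i^\bullet$ is a homogeneous polynomial, then $F_1^\bullet,\ldots,F_\ell^\bullet$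 generate $Z(\mathcal A,\tilde\pi)$ as an algebra.
   Context: Let $\Omega$ be the algebra of differential forms on $\mathbb A^n$ with polynomial coefficients and $W$ the graded skew-symmetric algebra of polynomial polyvector fields; $W^k=\Lambda^k_{\mathcal A}W^1$, where $W^1$ is the free $\mathcal A$-module with basis $\partial_{x_1},\ldots,\partial_{x_n}$, is viewed as the $\mathcal A$-dual of $\Omega^k=\Lambda^k_{\mathcal A}\Omega^1$ via $dx_i(\partial_{x_j})=\delta_{ij}$. Put $\omega=dx_1\wedge\ldots\wedge dx_n$. For $f\in\Omega^k$, the element $f/\omega\in(\Omega^{n-k})^*\cong W^{n-k}$ is defined by $(f/\omega)(g)=a$, where $f\wedge g=a\omega$, for $g\in\Omega^{n-k}$. The Poisson tensor of a Poisson bracket $\{\,,\}$ on $\mathcal A$ is the element $\pi\in W^2$ with $\pi(df\wedge dg)=\{f,g\}$ for all $f,g\in\mathcal A$; its coefficients are arbitrary polynomials. For a point $\xi$, $\pi_\xi$ is the skew-symmetric matrix with entries $\{x_i,x_j\}(\xi)$; $\mathrm{rk}\,\pi=\max_\xi\mathrm{rk}\,\pi_\xi$; the index is $n-\mathrm{rk}\,\pi$; $\mathrm{Sing}\,\pi=\{\xi\in\mathbb A^n\mid \mathrm{rk}\,\pi_\xi<\mathrm{rk}\,\pi\}$, a Zariski closed subvariety of the affine space $\mathbb A^n_{\mathbb K}$. $Z(\mathcal A,\pi)$ is the Poisson centre $\{a\in\mathcal A\mid\{a,\mathcal A\}=0\}$. $\Lambda^k\pi=\pi\wedge\ldots\wedge\pi\in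 W^{2k}$ ($k$ factors). Contraction: let $\varphi_t$ be a family of automorphisms given by a regular map $\mathbb K^\times\to\mathrm{GL}((\mathbb K^n)^* )$. Each $\varphi_t$ extends to $\mathbb K$-linear automorphisms of $\mathcal A$ (as an algebra, $\mathcal A$ being the symmetric algebra of $(\mathbb K^n)^*$), of $W$ and of $\Omega$. Put $\pi_t=\varphi_t^{-1}(\pi)$, i.e. the corresponding bracket is $\{f,g\}_t=\varphi_t^{-1}(\{\varphi_t(f),\varphi_t(g)\})$. If the formal expression of $\pi_t$ is an element of $W^2[t]$ (polynomial in $t$), then $\tilde\pi:=\lim_{t\to0}\pi_t$ (the value at $t=0$) is called a contraction of $\pi$; it is again a Poisson tensor. For non-zero $H\in\mathcal A$, $\deg_tH$ is the unique integer $d$ such that $H^\bullet:=\lim_{t\to0}t^d\varphi_t^{-1}(H)$ exists and is a non-zero polynomial; $H^\bullet$ is the highest ($t$-)component of $H$. *)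

(* Defs.v *)
From HB Require Import structures.
From mathcomp Require Import all_boot all_order all_algebra.
From mathcomp Require Import boolp.
From mathcomp.multinomials Require Import mpoly.

Set Implicit Arguments.
Unset Strict Implicit.
Unset Printing Implicit Defensive.

Import GRing.Theory.
Local Open Scope ring_scope.

(* The exterior algebra of the free module R^n, in coordinates with respect to
   the basis e_J = e_(j1) /\ ... /\ e_(jk), J = {j1 < ... < jk}. *)
Notation ext R n := {ffun {set 'I_n} -> R}.

Section Exterior.
Variables (R : comNzRingType) (n : nat).
Implicit Types (u v w : ext R n) (I J : {set 'I_n}).

Definition ext_basis J : ext R n := [ffun I : {set 'I_n} => (I == J)%:R].

Definition ext_one : ext R n := ext_basis set0.

Definition inversions I J : nat :=
  #|[set p : 'I_n * 'I_n | [&& p.1 \in I, p.2 \in J & (p.2 < p.1)%N]]|.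

Definition wedge u v : ext R n :=
  [ffun I : {set 'I_n} => \sum_(J : {set 'I_n} | J \subset I)
     (-1) ^+ inversions J (I :\: J) * u J * v (I :\: J)].

Definition wedge_pow (k : nat) u : ext R n := iter k (wedge u) ext_one.

Definition ext_deg (k : nat) u : Prop := forall J, u J != 0 -> #|J| = k.

(* The bases (e_J) of both factors are dual to each other, i.e. this is the
   pairing (v_1 /\ ... /\ v_k, g_1 /\ ... /\ g_k) |-> \det (g_i (v_j)). *)
Definition pairing w u : R := \sum_J w J * u J.

(* f / omega for omega = e_[set: 'I_n]; see div_omegaP. *)
Definition div_omega u : ext R n :=
  [ffun J : {set 'I_n} => wedge u (ext_basis J) [set: 'I_n]].

Lemma pairing_div_omega u v : pairing (div_omega u) v = wedge u v [set: 'I_n].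
Proof.
rewrite /pairing /div_omega [RHS]ffunE.
under eq_bigr => J _ do rewrite !ffunE mulr_suml.
rewrite exchange_big /=; apply: eq_bigr => I _.
rewrite (bigD1 (setT :\: I)) //= ffunE eqxx mulr1 big1 ?addr0 // => J.
by rewrite ffunE eq_sym => /negPf ->; rewrite mulr0 mul0r.
Qed.

Lemma div_omegaP k u v : (k <= n)%N -> ext_deg k u -> ext_deg (n - k) v ->
  wedge u v =
    [ffun J : {set 'I_n} => pairing (div_omega u) v * ext_basis [set: 'I_n] J].
Proof.
move=> kn du dv; apply/ffunP => I; rewrite pairing_div_omega [RHS]ffunE.
rewrite [ext_basis _ _]ffunE; have [->|nT] := eqVneq I setT.
  by rewrite mulr1.
rewrite mulr0 ffunE big1 // => J sJI.
have [->|/du uJ] := eqVneq (u J) 0; first by rewrite mulr0 mul0r.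
have [->|/dv vJ] := eqVneq (v (I :\: J)) 0; first by rewrite mulr0.
case/eqP: nT; apply/eqP; rewrite eqEcard subsetT cardsT card_ord /=.
by rewrite -(cardsID J I) (setIidPr sJI) uJ vJ subnKC.
Qed.

End Exterior.

Section Poisson.
Variables (K : fieldType) (n : nat).
Local Notation A := {mpoly K[n]}.
(* Differential forms and polyvector fields: e_J stands for
   dx_(j1) /\ ... /\ dx_(jk) and for its dual, respectively. *)
Local Notation Omega := (ext A n).
Local Notation W := (ext A n).

Definition dform (f : A) : Omega :=
  [ffun J : {set 'I_n} => \sum_(i < n) f^`M(i) * ext_basis A [set i] J].

Definition tensor_bracket (w : W) (f g : A) : A :=
  pairing w (wedge (dform f) (dform g)).

Record is_poisson_bracket (br : A -> A -> A) : Prop := IsPoissonBracket {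
  pb_linear : forall (c : K) f g h, br (c *: f + g) h = c *: br f h + br g h;
  pb_skew : forall f g, br f g = - br g f;
  pb_leibniz : forall f g h, br f (g * h) = br f g * h + g * br f h;
  pb_jacobi : forall f g h, br f (br g h) + br g (br h f) + br h (br f g) = 0
}.

Definition is_tensor_of (br : A -> A -> A) (w : W) : Prop :=
  ext_deg 2 w /\ forall f g, tensor_bracket w f g = br f g.

Definition is_poisson_tensor (w : W) : Prop :=
  ext_deg 2 w /\ is_poisson_bracket (tensor_bracket w).

Definition in_center (w : W) (a : A) : Prop :=
  forall b, tensor_bracket w a b = 0.

(* The matrix of w at a point xi of the affine space with values in an
   extension field iota : K -> L. *)
Definition tensor_at (L : fieldType) (iota : {rmorphism K -> L})
    (xi : 'I_n -> L) (w : W) : 'M[L]_n :=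
  \matrix_(i, j) mmap iota xi (tensor_bracket w 'X_i 'X_j).

Definition tensor_rank (w : W) : nat :=
  \max_(r < n.+1 |
    `[< exists xi : 'I_n -> K, \rank (tensor_at idfun xi w) = r >]) r.

Definition tensor_index (w : W) : nat := (n - tensor_rank w)%N.

(* Sing w as a subset of Spec A: a point is represented by the prime ideal of
   the polynomials vanishing at a field-valued point xi of the affine space
   (every prime ideal arises in this way, from its residue field).  The K-valued
   points alone would not do, as K need not be algebraically closed. *)
Definition sing (w : W) (P : A -> Prop) : Prop :=
  exists (L : fieldType) (iota : {rmorphism K -> L}) (xi : 'I_n -> L),
    (forall a, P a <-> mmap iota xi a = 0) /\
    (\rank (tensor_at iota xi w) < tensor_rank w)%N.

(* The dimension of a closed subset S of Spec A, as the supremum of the lengths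
   of the chains of primes in S; the empty set has dimension -oo. *)
Definition dim_le (S : (A -> Prop) -> Prop) (m : int) : Prop :=
  forall (k : nat) (P : nat -> A -> Prop),
    (forall i, (i <= k)%N -> S (P i)) ->
    (forall i, (i < k)%N ->
       (forall a, P i a -> P i.+1 a) /\ exists a, P i.+1 a /\ ~ P i a) ->
    k%:Z <= m.

Definition kostant (l : nat) (F : l.-tuple A) (w : W) : Prop :=
  div_omega (\big[@wedge A n/ext_one A n]_(i < l) dform (tnth F i))
    = wedge_pow (n - l)./2 w.

(* The automorphism of A extending the linear map x_i |-> \sum_j M i j x_j. *)
Definition lin_act (M : 'M[K]_n) (f : A) : A :=
  f \mPo [tuple \sum_(j < n) M i j *: 'X_j | i < n].

(* The value at 0 is irrelevant, here and below. *)
Definition regular_family (phi : K -> 'M[K]_n) : Prop :=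
  (forall t : K, t != 0 -> phi t \in unitmx) /\
  exists (N : nat) (P : 'M[{poly K}]_n),
    forall t : K, t != 0 -> forall i j, t ^+ N * phi t i j = (P i j).[t].

(* u t is polynomial in t, and l is the value of this polynomial at t = 0. *)
Definition is_lim0 (V : lmodType K) (u : K -> V) (l : V) : Prop :=
  exists (m : nat) (c : nat -> V),
    (forall t : K, t != 0 -> u t = \sum_(k < m.+1) t ^+ k *: c k) /\ l = c 0%N.

Definition conj_bracket (M : 'M[K]_n) (br : A -> A -> A) (f g : A) : A :=
  lin_act (invmx M) (br (lin_act M f) (lin_act M g)).

Definition is_contraction (phi : K -> 'M[K]_n) (w wlim : W) : Prop :=
  exists wt : K -> W,
    (forall t : K, t != 0 ->
       is_tensor_of (conj_bracket (phi t) (tensor_bracket w)) (wt t)) /\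
    is_lim0 wt wlim.

(* d is the t-degree of H, and Hb is its highest t-component. *)
Definition is_highest_component (phi : K -> 'M[K]_n) (H : A) (d : int) (Hb : A)
    : Prop :=
  is_lim0 (fun t => t ^ d *: lin_act (invmx (phi t)) H) Hb /\ Hb != 0.

Definition alg_dependent (l : nat) (F : l.-tuple A) : Prop :=
  exists2 P : {mpoly K[l]}, P != 0 & P \mPo F = 0.

Definition alg_independent (l : nat) (F : l.-tuple A) : Prop :=
  forall P : {mpoly K[l]}, P \mPo F = 0 -> P = 0.

Definition generates (l : nat) (F : l.-tuple A) (S : A -> Prop) : Prop :=
  forall a, S a <-> exists P : {mpoly K[l]}, a = P \mPo F.

End Poisson.

(* Main.v *)
Require Import Defs.
From HB Require Import structures.
From mathcomp Require Import all_boot all_order all_fingroup all_algebra.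
From mathcomp Require Import generic_quotient ring_quotient fraction ring.
From mathcomp.multinomials Require Import mpoly.
From mathcomp Require boolp.

(** Write m for (n - l)/2.  In the Kostant equality dF_1 /\ ... /\ dF_l / omega = pi^m,
    evaluated on dg_1 /\ ... /\ dg_k, the left side is a Jacobian determinant and
    the right side is a universal polynomial, a multiple of a Pfaffian, in the
    brackets {g_i, g_j} ([epair_exp_prod_map]).  A linear change of variables
    therefore multiplies the left side by its determinant ([full_lin_act]) and
    replaces the bracket by the conjugate one on the right side
    ([kostant_lin_act]).  For phi_t^-1 and G_i = t^(d_i) phi_t^-1(F_i) this reads

      dG_1 /\ ... /\ dG_l / omega = t^(sum d_i - D) pi_t^m

    for all t <> 0.  The coefficients of the G_i and of pi_t are polynomials in t
    and K is infinite, so this is an identity of polynomials, up to a power of t,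
    and may be evaluated at t = 0 ([kostant_poly]).  The limit tensor has rank
    n - l, hence its m-th power is not zero ([exp_eq0_rank]).

    - If sum d_i < D, the limit of the right side would be zero after multiplication
      by a positive power of t: impossible.
    - If sum d_i > D, the differentials of the limits Fb_i have a zero product, and the
      Jacobian criterion ([zero_wedge_alg_dependent]) gives an algebraic relation.
    - If sum d_i = D, the value at t = 0 is the Kostant equality for the limits.  The
      product of the dFb_i is then not zero, which forbids algebraic relations
      ([nonzero_wedge_alg_independent]).

    For the last assertion, let a be in the centre of the limit tensor.  The
    contraction of that tensor with da vanishes, hence so does the contraction of
    its m-th power, and the Kostant equality turns this into
    da /\ dFb_1 /\ ... /\ dFb_l = 0 ([center_kostant_wedge]).  So da is a combination of
    the dFb_i with rational coefficients c_i, whose denominators divide all the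
    coefficients of dFb_1 /\ ... /\ dFb_l.  These have no common prime factor q: they are
    homogeneous, so q would vanish at the origin, and the ideal (q) would start a
    chain of n primes containing q ([prime_chain_through]); all of these lie in the
    singular locus, whose dimension is at most n - 2.  As polynomial rings are
    factorial, the c_i are polynomials ([df_integral_span]).  Differentiating
    da = sum c_i dFb_i shows that the c_i satisfy the same equation as a
    ([span_coef_closed]), and for a homogeneous of degree k > 0 they have smaller
    degree.  By induction the c_i are polynomials in the Fb_i, and Euler's formula
    k a = sum c_i deg(Fb_i) Fb_i finishes the proof ([homog_generated]). *)

Set Implicit Arguments.
Unset Strict Implicit.
Unset Printing Implicit Defensive.

Import Order.TTheory GRing.Theory Num.Theory.
Local Open Scope ring_scope.

(** * The exterior algebra *)
(** The type of forms under a name of its own, so that multiplication can be the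
    wedge product; functions with values in a ring also have a pointwise product. *)
Definition exterior (R : comNzRingType) (n : nat) : Type :=
  {ffun {set 'I_n} -> R^o}.

HB.instance Definition _ (R : comNzRingType) n :=
  GRing.Lmodule.on (exterior R n).

HB.lock Definition ewedge (R : comNzRingType) (n : nat) (u v : exterior R n) :
  exterior R n := wedge (u : ext R n) (v : ext R n).

Section ExteriorRing.
Variables (R : comNzRingType) (n : nat).
Local Notation E := (exterior R n).
Implicit Types (u v w : E) (I J L : {set 'I_n}).

Lemma exteriorD u v I : (u + v) I = u I + v I :> R.
Proof. by rewrite ffunE. Qed.

Lemma exteriorZ (c : R) u I : (c *: u) I = c * u I.
Proof. by rewrite ffunE. Qed.

Lemma exterior0 I : (0 : E) I = 0 :> R.
Proof. by rewrite ffunE. Qed.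

Lemma exterior_sum (T : Type) (s : seq T) (P : pred T) (F : T -> E) I :
  (\sum_(x <- s | P x) F x) I = \sum_(x <- s | P x) F x I.
Proof.
by elim/big_rec2: _ => [|x a b _ <-]; rewrite ?exterior0 ?exteriorD.
Qed.

Definition ebasis (I : {set 'I_n}) : E := ext_basis R I.

Lemma ebasisE I J : ebasis I J = (J == I)%:R :> R.
Proof. by rewrite ffunE. Qed.

Lemma exterior_basis u : u = \sum_I u I *: ebasis I.
Proof.
apply/ffunP=> J; rewrite exterior_sum (bigD1 J) //= exteriorZ ebasisE eqxx mulr1.
rewrite big1 ?addr0 // => I /negPf neIJ.
by rewrite exteriorZ ebasisE eq_sym neIJ mulr0.
Qed.


Fact ewedgeDl : left_distributive (@ewedge R n) +%R.
Proof.
rewrite ewedge.unlock => u v w; apply/ffunP=> I;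
  rewrite exteriorD !ffunE -big_split /=.
by apply: eq_bigr => J _; rewrite ffunE mulrDr mulrDl.
Qed.

Fact ewedgeDr : right_distributive (@ewedge R n) +%R.
Proof.
rewrite ewedge.unlock => u v w; apply/ffunP=> I;
  rewrite exteriorD !ffunE -big_split /=.
by apply: eq_bigr => J _; rewrite ffunE mulrDr.
Qed.

Fact ewedgeZl c u v : ewedge (c *: u) v = c *: ewedge u v.
Proof.
rewrite ewedge.unlock; apply/ffunP=> I; rewrite exteriorZ !ffunE mulr_sumr.
by apply: eq_bigr => J _; rewrite exteriorZ mulrCA !mulrA.
Qed.

Fact ewedgeZr c u v : ewedge u (c *: v) = c *: ewedge u v.
Proof.
rewrite ewedge.unlock; apply/ffunP=> I; rewrite exteriorZ !ffunE mulr_sumr.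
by apply: eq_bigr => J _; rewrite exteriorZ mulrCA.
Qed.

Fact ewedge0l u : ewedge 0 u = 0.
Proof. by rewrite -(scale0r u) ewedgeZl !scale0r. Qed.

Fact ewedge0r u : ewedge u 0 = 0.
Proof. by rewrite -(scale0r u) ewedgeZr !scale0r. Qed.

Fact ewedge_suml (T : Type) (s : seq T) (P : pred T) (F : T -> E) u :
  ewedge (\sum_(x <- s | P x) F x) u = \sum_(x <- s | P x) ewedge (F x) u.
Proof.
by elim/big_rec2: _ => [|x v w _ <-]; rewrite ?ewedge0l ?ewedgeDl.
Qed.

Fact ewedge_sumr (T : Type) (s : seq T) (P : pred T) (F : T -> E) u :
  ewedge u (\sum_(x <- s | P x) F x) = \sum_(x <- s | P x) ewedge u (F x).
Proof. by elim/big_rec2: _ => [|x v w _ <-]; rewrite ?ewedge0r ?ewedgeDr. Qed.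

Fact ewedge_basis I J : ewedge (ebasis I) (ebasis J) =
  if [disjoint I & J] then (-1) ^+ inversions I J *: ebasis (I :|: J) else 0.
Proof.
rewrite ewedge.unlock; apply/ffunP=> L; rewrite ffunE.
have [dIJ|ndIJ] := ifPn.
  rewrite exteriorZ ebasisE; have [->|neL] := eqVneq L (I :|: J).
    rewrite (bigD1 I) ?subsetUl //= !ebasisE eqxx.
    have -> : (I :|: J) :\: I = J.
      by rewrite setDUl setDv set0U; apply/setDidPl; rewrite disjoint_sym.
    rewrite eqxx !mulr1 big1 ?addr0 // => M /andP[_ /negPf neMI].
    by rewrite ebasisE neMI mulr0 mul0r.
  rewrite mulr0 big1 // => M sML; rewrite !ebasisE.
  have [eMI|_] := eqVneq M I; last by rewrite mulr0 mul0r.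
  have [eJ|_] := eqVneq (L :\: M) J; last by rewrite mulr0.
  case/eqP: neL; rewrite -eMI -eJ setDE setUIr setUCr setIT.
  by apply/esym/setUidPr.
rewrite exterior0 big1 // => M sML; rewrite !ebasisE.
have [eMI|_] := eqVneq M I; last by rewrite mulr0 mul0r.
have [eJ|_] := eqVneq (L :\: M) J; last by rewrite mulr0.
case/negP: ndIJ; rewrite -eMI -eJ.
by rewrite -setI_eq0 setDE setICA setICr setI0.
Qed.

(** Inversions count pairs, so they add up over disjoint unions: this is what makes
    the wedge product associative. *)
Lemma inversionsUl I J L : [disjoint I & J] ->
  inversions (I :|: J) L = (inversions I L + inversions J L)%N.
Proof.
move=> dIJ; rewrite /inversions.
rewrite -cardsUI [X in (_ + #|pred_of_set X|)%N](_ : _ = set0) ?cards0 ?addn0;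
  last first.
  apply/setP=> -[a b]; rewrite !inE /=.
  have := disjointFr dIJ (x := a); case: (a \in I) => // -> //.
  by rewrite andbF.
congr #|pred_of_set _|; apply/setP=> -[a b]; rewrite !inE /=.
by rewrite andb_orl.
Qed.

Lemma inversionsUr I J L : [disjoint J & L] ->
  inversions I (J :|: L) = (inversions I J + inversions I L)%N.
Proof.
move=> dJL; rewrite /inversions.
rewrite -cardsUI [X in (_ + #|pred_of_set X|)%N](_ : _ = set0) ?cards0 ?addn0;
  last first.
  apply/setP=> -[a b]; rewrite !inE /=.
  have := disjointFr dJL (x := b); case: (b \in J) => [->|] //;
  by rewrite ?andbF.
congr #|pred_of_set _|; apply/setP=> -[a b]; rewrite !inE /=.
by rewrite andb_orl andb_orr.
Qed.

Fact ewedgeA_basis I J L :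
  ewedge (ebasis I) (ewedge (ebasis J) (ebasis L)) = ewedge (ewedge (ebasis I) (ebasis J)) (ebasis L).
Proof.
rewrite !ewedge_basis.
have dU (A B C : {set 'I_n}) : [disjoint A & B :|: C] = [disjoint A & B] && [disjoint A & C].
  by rewrite -!setI_eq0 setIUr setU_eq0.
have [dJL|dJL] := boolP [disjoint J & L]; have [dIJ|dIJ] := boolP [disjoint I & J].
- rewrite ewedgeZr ewedgeZl !ewedge_basis.
  rewrite dU dIJ [X in _ = _ *: (if X then _ else _)]disjoint_sym dU.
  rewrite ![[disjoint L & _]]disjoint_sym dJL andbT /=.
  have [dIL|_] := ifP; last by rewrite !scaler0.
  rewrite !scalerA -!exprD inversionsUl // inversionsUr //.
  rewrite setUA; congr (_ ^+ _ *: _).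
  by rewrite addnC -addnA; congr (_ + _)%N.
- by rewrite ewedge0l ewedgeZr ewedge_basis dU (negPf dIJ) scaler0.
- rewrite ewedge0r ewedgeZl ewedge_basis disjoint_sym dU.
  by rewrite ![[disjoint L & _]]disjoint_sym (negPf dJL) andbF scaler0.
by rewrite ewedge0l ewedge0r.
Qed.

Fact ewedgeA : associative (@ewedge R n).
Proof.
move=> u v w.
rewrite (exterior_basis u) !ewedge_suml; apply: eq_bigr => I _.
rewrite !ewedgeZl; congr (_ *: _).
rewrite (exterior_basis v) ewedge_suml !ewedge_sumr ewedge_suml.
apply: eq_bigr => J _; rewrite ewedgeZl !ewedgeZr ewedgeZl; congr (_ *: _).
rewrite (exterior_basis w) !ewedge_sumr.
by apply: eq_bigr => L _; rewrite !ewedgeZr ewedgeA_basis.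
Qed.

Definition eone : E := ext_one R n.

Fact ewedge1l : left_id eone (@ewedge R n).
Proof.
move=> u; rewrite (exterior_basis u) ewedge_sumr; apply: eq_bigr => I _.
rewrite ewedgeZr; congr (_ *: _).
rewrite -[eone]/(ebasis set0) ewedge_basis disjoint_sym.
rewrite -setI_eq0 setI0 eqxx set0U.
rewrite /inversions [X in #|pred_of_set X|](_ : _ = set0) ?cards0 ?scale1r //.
by apply/setP=> p; rewrite !inE.
Qed.

Fact ewedge1r : right_id eone (@ewedge R n).
Proof.
move=> u; rewrite (exterior_basis u) ewedge_suml; apply: eq_bigr => I _.
rewrite ewedgeZl; congr (_ *: _).
rewrite -[eone]/(ebasis set0) ewedge_basis.
rewrite -setI_eq0 setI0 eqxx setU0.
rewrite /inversions [X in #|pred_of_set X|](_ : _ = set0) ?cards0 ?scale1r //.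
by apply/setP=> p; rewrite !inE andbF.
Qed.

Fact eone_neq0 : eone != 0.
Proof.
by apply/eqP=> /ffunP/(_ set0)/eqP; rewrite !ffunE eqxx oner_eq0.
Qed.

HB.instance Definition _ := GRing.Zmodule_isNzRing.Build E
  ewedgeA ewedge1l ewedge1r ewedgeDl ewedgeDr eone_neq0.

HB.instance Definition _ := GRing.Lmodule_isLalgebra.Build R E
  (fun c u v => esym (ewedgeZl c u v)).
HB.instance Definition _ := GRing.Lalgebra_isAlgebra.Build R E
  (fun c u v => esym (ewedgeZr c u v)).

Lemma wedgeE (u v : ext R n) : wedge u v = (u : E) * (v : E).
Proof. by rewrite /GRing.mul /= ewedge.unlock. Qed.

Lemma wedge_powE k (u : ext R n) : wedge_pow k u = (u : E) ^+ k.
Proof. by elim: k => //= k; rewrite exprS -wedgeE /wedge_pow /= => ->. Qed.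

Lemma big_wedgeE (T : Type) (s : seq T) (F : T -> ext R n) :
  \big[@wedge R n/ext_one R n]_(i <- s) F i = \prod_(i <- s) (F i : E).
Proof.
by elim: s => [|x s IHs]; rewrite ?big_nil // !big_cons IHs wedgeE.
Qed.

End ExteriorRing.

(** * Vectors and interior products *)
Section Contraction.
Variables (R : comNzRingType) (n : nat).
Local Notation E := (exterior R n).
Implicit Types (u w : E) (I J L : {set 'I_n}) (a b v : 'I_n -> R) (i j k : 'I_n).

Definition evec v : E := [ffun J => \sum_(i < n) v i * ext_basis R [set i] J].

Lemma evecE v : evec v = \sum_i v i *: ebasis R [set i].
Proof.
apply/ffunP=> J; rewrite exterior_sum ffunE.
by apply: eq_bigr => i _; rewrite exteriorZ.
Qed.

Lemma evec_linear c v a :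
  evec (fun i => c * v i + a i) = c *: evec v + evec a.
Proof.
rewrite !evecE scaler_sumr -big_split; apply: eq_bigr => i _.
by rewrite /= scalerDl scalerA.
Qed.

Lemma eq_evec v a : v =1 a -> evec v = evec a.
Proof. by move=> eq_va; rewrite !evecE; apply: eq_bigr => i _; rewrite eq_va. Qed.

Lemma evecZ c v : evec (fun i => c * v i) = c *: evec v.
Proof. by rewrite !evecE scaler_sumr; apply: eq_bigr => i _; rewrite scalerA. Qed.

Lemma evec_sum (T : Type) (s : seq T) (P : pred T) (F : T -> 'I_n -> R) :
  evec (fun i => \sum_(x <- s | P x) F x i) = \sum_(x <- s | P x) evec (F x).
Proof.
rewrite evecE; under eq_bigr do rewrite scaler_suml.
by rewrite exchange_big; apply: eq_bigr => x _; rewrite evecE.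
Qed.

Definition edelta (i j : 'I_n) : R := (i == j)%:R.

Lemma evec_delta i : evec (edelta i) = ebasis R [set i].
Proof.
rewrite evecE (bigD1 i) //= /edelta eqxx scale1r big1 ?addr0 // => j /negPf.
by rewrite eq_sym => ->; rewrite scale0r.
Qed.

(** The number of transpositions that move [i] to its place in front of [J]. *)
Definition below (i : 'I_n) (J : {set 'I_n}) := #|[set j in J | (j < i)%N]|.

Lemma ebasis_mul I J : ebasis R I * ebasis R J =
  if [disjoint I & J] then (-1) ^+ inversions I J *: ebasis R (I :|: J) else 0.
Proof. exact: ewedge_basis. Qed.

Lemma ebasis1_mul i J : ebasis R [set i] * ebasis R J =
  if i \in J then 0 else (-1) ^+ below i J *: ebasis R (i |: J).
Proof.
rewrite ebasis_mul disjoints1; case: (i \in J) => //=; congr (_ ^+ _ *: _).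
have inj : injective (pair i : 'I_n -> _) by move=> x y [].
rewrite /inversions /below -[RHS](card_imset _ inj).
congr #|pred_of_set _|; apply/setP=> -[k j]; apply/idP/imsetP => /=.
  by rewrite !inE /= => /and3P[/eqP-> jJ ltji]; exists j; rewrite ?inE ?jJ.
by case=> x; rewrite !inE /= => /andP[xJ ltxi] [-> ->]; rewrite eqxx xJ.
Qed.

Lemma below_setU1 i k J : k \notin J -> below i (k |: J) = (below i J + (k < i))%N.
Proof.
move=> kJ; rewrite /below.
have [lt_ki|le_ik] := ltnP k i.
  have -> : [set j in k |: J | (j < i)%N] = k |: [set j in J | (j < i)%N].
    by apply/setP=> j; rewrite !inE andb_orl; case: eqP => [->|]; rewrite ?lt_ki.
  by rewrite cardsU1 !inE (negPf kJ) addnC.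
rewrite addn0; congr #|pred_of_set _|; apply/setP=> j; rewrite !inE andb_orl.
by case: eqP => [->|] //=; rewrite ltnNge le_ik andbF.
Qed.

Lemma below_setD1 i k J : k \in J -> below i J = (below i (J :\ k) + (k < i))%N.
Proof. by move=> kJ; rewrite -{1}(setD1K kJ) below_setU1 // !inE eqxx. Qed.

Lemma ebasis1_mulC i j :
  ebasis R [set i] * ebasis R [set j] = - (ebasis R [set j] * ebasis R [set i]).
Proof.
rewrite !ebasis1_mul !inE [j == i]eq_sym setUC.
have [|neij] := eqVneq; first by rewrite oppr0.
have b1 (k m : 'I_n) : below k [set m] = (m < k)%N.
  by rewrite -(setU0 [set m]) below_setU1 ?inE // /below; 
     rewrite (_ : [set _ in _ | _] = set0) ?cards0 //; apply/setP=> x; rewrite !inE.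
rewrite !b1 -scaleNr; case: ltngtP => [lt|lt|/ord_inj eij].
- by [].
- by rewrite /= expr1 opprK.
by rewrite eij eqxx in neij.
Qed.

Lemma evecC a b : evec a * evec b = - (evec b * evec a).
Proof.
rewrite !evecE !mulr_suml.
under eq_bigr do rewrite mulr_sumr; under [in RHS]eq_bigr do rewrite mulr_sumr.
rewrite [in RHS]exchange_big -sumrN; apply: eq_bigr => i _; rewrite -sumrN.
apply: eq_bigr => j _; rewrite -!scalerAl -!scalerAr (ebasis1_mulC i j).
by rewrite !scalerN !scalerA (mulrC (a i)).
Qed.

(** Anticommutativity alone gives this only when 2 is regular.  In general, squaring is
    additive on anticommuting elements and kills the multiples of basis vectors. *)
Lemma evec_sq a : evec a * evec a = 0.
Proof.
pose P (x : E) := x * x = 0 /\ exists b, x = evec b.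
have [] // : P (evec a).
rewrite evecE; apply: (big_ind P) => [|x y [x0 [b xb]] [y0 [c yc]]|i _].
- split; rewrite ?mulr0 //; exists (fun=> 0).
  by rewrite evecE big1 // => i _; rewrite scale0r.
- split; last first.
    exists (fun i => 1 * b i + c i).
    by rewrite evec_linear scale1r xb yc.
  by rewrite mulrDl !mulrDr x0 y0 xb yc evecC addr0 add0r addrC subrr.
split; last by exists (fun j => a i * edelta i j); rewrite evecZ evec_delta.
by rewrite -scalerAl -scalerAr ebasis1_mul set11 !scaler0.
Qed.

Definition epair w u : R := pairing w u.

Lemma epairC w u : epair w u = epair u w.
Proof. by apply: eq_bigr => J _; rewrite mulrC. Qed.

Lemma epairDr w u1 u2 : epair w (u1 + u2) = epair w u1 + epair w u2.
Proof.
by rewrite -big_split; apply: eq_bigr => J _; rewrite exteriorD mulrDr.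
Qed.

Lemma epairZr w c u : epair w (c *: u) = c * epair w u.
Proof.
by rewrite mulr_sumr; apply: eq_bigr => J _; rewrite exteriorZ mulrCA.
Qed.

Lemma epair_sumr (T : Type) (s : seq T) (P : pred T) (F : T -> E) w :
  epair w (\sum_(x <- s | P x) F x) = \sum_(x <- s | P x) epair w (F x).
Proof.
apply: (big_morph (epair w) (epairDr w)).
by rewrite -(scale0r w) epairZr mul0r.
Qed.

Lemma epairDl w u1 u2 : epair (u1 + u2) w = epair u1 w + epair u2 w.
Proof. by rewrite !(epairC _ w) epairDr. Qed.

Lemma epairZl w c u : epair (c *: u) w = c * epair u w.
Proof. by rewrite !(epairC _ w) epairZr. Qed.

Lemma epair_ebasisl J u : epair (ebasis R J) u = u J.
Proof.
rewrite /epair /pairing (bigD1 J) //= ebasisE eqxx mul1r big1 ?addr0 // => I.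
by rewrite ebasisE => /negPf->; rewrite mul0r.
Qed.

Lemma epair_ebasisr J u : epair u (ebasis R J) = u J.
Proof. by rewrite epairC epair_ebasisl. Qed.

(** Interior product with [a], as the adjoint of the product with [a]; the sign rule
    is then [contr_mul]. *)
Definition contr a w : E := [ffun J => epair w (evec a * ebasis R J)].

Lemma contrE a w J : contr a w J = epair w (evec a * ebasis R J).
Proof. by rewrite ffunE. Qed.

Lemma contr_adj a w u : epair (contr a w) u = epair w (evec a * u).
Proof.
rewrite {2}(exterior_basis u) mulr_sumr epair_sumr.
by apply: eq_bigr => J _; rewrite contrE -scalerAr epairZr mulrC.
Qed.

Lemma contrD a w u : contr a (w + u) = contr a w + contr a u.
Proof. by apply/ffunP=> J; rewrite exteriorD !contrE epairDl. Qed.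

Lemma contrZ a c w : contr a (c *: w) = c *: contr a w.
Proof. by apply/ffunP=> J; rewrite exteriorZ !contrE epairZl. Qed.

Lemma contr0 a : contr a 0 = 0.
Proof. by rewrite -(scale0r (0 : E)) contrZ !scale0r. Qed.

Lemma contr_sum a (T : Type) (s : seq T) (P : pred T) (F : T -> E) :
  contr a (\sum_(x <- s | P x) F x) = \sum_(x <- s | P x) contr a (F x).
Proof. exact: (big_morph (contr a) (contrD a) (contr0 a)). Qed.

Lemma contr_coord a w : contr a w = \sum_i a i *: contr (edelta i) w.
Proof.
apply/ffunP=> J; rewrite contrE exterior_sum evecE mulr_suml epair_sumr.
by apply: eq_bigr => i _; rewrite exteriorZ contrE -scalerAl epairZr evec_delta.
Qed.

Lemma contr_ebasis i J : contr (edelta i) (ebasis R J) =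
  if i \in J then (-1) ^+ below i J *: ebasis R (J :\ i) else 0.
Proof.
apply/ffunP=> L; rewrite contrE epair_ebasisl evec_delta ebasis1_mul.
have [iL|iL] := ifP; have [iJ|iJ] := ifP; rewrite ?exterior0 // ?exteriorZ ?ebasisE.
- have [eL|_] := eqVneq L (J :\ i); last by rewrite mulr0.
  by rewrite eL !inE eqxx in iL.
- have [eJ|neJ] := eqVneq J (i |: L).
    by rewrite eJ setU1K ?iL // eqxx below_setU1 ?iL // ltnn addn0.
  have [eL|_] := eqVneq L (J :\ i); last by rewrite !mulr0.
  by rewrite eL setD1K // eqxx in neJ.
have [eJ|_] := eqVneq J (i |: L); last by rewrite mulr0.
by rewrite eJ !inE eqxx in iJ.
Qed.

(** By linearity this is an identity between basis elements.  If [i] is in [J] and [k]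
    is not, the two orders of removing [i] and inserting [k] differ by one
    transposition, because exactly one of i < k and k < i holds. *)
Lemma contr_mul a v w :
  contr a (evec v * w) = (\sum_i a i * v i) *: w - evec v * contr a w.
Proof.
suffices basis i k J : contr (edelta i) (ebasis R [set k] * ebasis R J) =
    edelta i k *: ebasis R J - ebasis R [set k] * contr (edelta i) (ebasis R J).
  have vec i k u : contr (edelta i) (ebasis R [set k] * u) =
      edelta i k *: u - ebasis R [set k] * contr (edelta i) u.
    rewrite (exterior_basis u) mulr_sumr !contr_sum mulr_sumr scaler_sumr -sumrB.
    apply: eq_bigr => J _; rewrite -scalerAr !contrZ basis scalerBr -scalerAr.
    by rewrite !scalerA mulrC.
  rewrite contr_coord [contr a w]contr_coord scaler_suml mulr_sumr -sumrB.
  apply: eq_bigr => i _; rewrite -scalerAr -scalerA -scalerBr; congr (_ *: _).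
  rewrite evecE !mulr_suml contr_sum;
    under eq_bigr do rewrite -scalerAl contrZ vec scalerBr.
  rewrite sumrB; congr (_ - _); last by apply: eq_bigr => k _; rewrite -scalerAl.
  rewrite (bigD1 i) //= /edelta eqxx scale1r big1 ?addr0 // => k /negPf.
  by rewrite eq_sym => ->; rewrite scale0r scaler0.
rewrite contr_ebasis ebasis1_mul /edelta.
have [<-|neik] := eqVneq i k.
  rewrite scale1r; have [iJ|iJ] := ifP.
    rewrite contr0 -scalerAr ebasis1_mul !inE eqxx /= setD1K // (below_setD1 i iJ).
    by rewrite ltnn addn0 scalerA -expr2 sqrr_sign scale1r subrr.
  rewrite contrZ contr_ebasis setU11 setU1K ?iJ // below_setU1 ?iJ // ltnn addn0.
  by rewrite scalerA -expr2 sqrr_sign scale1r mulr0 subr0.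
rewrite scale0r sub0r; have [kJ|kJ] := ifP.
  rewrite contr0; case: ifP => iJ; last by rewrite mulr0 oppr0.
  by rewrite -scalerAr ebasis1_mul !inE kJ eq_sym neik scaler0 oppr0.
rewrite contrZ contr_ebasis !inE (negPf neik) /=; case: ifP => iJ; last first.
  by rewrite scaler0 mulr0 oppr0.
rewrite -scalerAr ebasis1_mul !inE kJ andbF !scalerA -scaleNr.
have -> : (k |: J) :\ i = k |: (J :\ i).
  by apply/setP=> x; rewrite !inE; case: (eqVneq x k) => [->|];
    rewrite ?orbF //= eq_sym neik.
congr (_ *: _); rewrite (below_setU1 i) ?kJ // (below_setD1 k iJ) -!exprD.
have ltgt : ((i < k) + (k < i) = 1)%N.
  by case: ltngtP => // /ord_inj eik; rewrite eik eqxx in neik.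
by rewrite addnACA ltgt addn1 exprS mulN1r addnC.
Qed.

End Contraction.

(** * Grading, products of vectors and powers of bivectors *)
Section Degree.
Variables (R : comNzRingType) (n : nat).
Local Notation E := (exterior R n).
Implicit Types (u w : E) (I J L : {set 'I_n}) (a b v : 'I_n -> R) (i j k : 'I_n).

(** The predicate [ext_deg] on the algebra [exterior]. *)
Definition edeg (d : nat) (u : E) : Prop := forall J, u J != 0 -> #|J| = d.

Lemma edeg_eq0 d u J : edeg d u -> #|J| != d -> u J = 0.
Proof. by move=> du; apply: contraNeq => /du ->. Qed.

Lemma edegM d e u w : edeg d u -> edeg e w -> edeg (d + e) (u * w).
Proof.
move=> du dw I; apply: contraNeq => neI; rewrite -wedgeE ffunE big1 // => J sJI.
have [->|/du uJ] := eqVneq (u J) 0; first by rewrite mulr0 mul0r.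
have [->|/dw wJ] := eqVneq (w (I :\: J)) 0; first by rewrite mulr0.
by rewrite -(cardsID J I) (setIidPr sJI) uJ wJ eqxx in neI.
Qed.

Lemma edeg1 : edeg 0 (1 : E).
Proof.
by move=> J; rewrite ffunE; have [->|] := eqVneq J set0; rewrite ?cards0 ?eqxx.
Qed.

Lemma edeg_ebasis J : edeg #|J| (ebasis R J).
Proof. by move=> I; rewrite ebasisE; case: (eqVneq I J) => [->|];
  rewrite ?eqxx. Qed.

Lemma edegX d u m : edeg d u -> edeg (d * m) (u ^+ m).
Proof.
move=> du; elim: m => [|m IHm]; first by rewrite muln0; apply: edeg1.
by rewrite exprS mulnS; apply: edegM.
Qed.

Lemma edeg_evec v : edeg 1 (evec v).
Proof.
move=> J; apply: contraNeq => neJ; rewrite ffunE big1 // => i _.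
by rewrite ffunE; case: (eqVneq J [set i]) neJ => [->|_ _];
  rewrite ?cards1 // mulr0.
Qed.

Lemma edeg_prod (T : Type) (s : seq T) (al : T -> 'I_n -> R) :
  edeg (size s) (\prod_(x <- s) evec (al x)).
Proof.
elim: s => [|x s IHs]; rewrite ?big_nil ?big_cons; first exact: edeg1.
by rewrite /= -add1n; apply: edegM => //; apply: edeg_evec.
Qed.

Lemma edeg_contr d a w : edeg d.+1 w -> edeg d (contr a w).
Proof.
move=> dw J; apply: contraNeq => neJ; rewrite contrE /epair /pairing.
rewrite big1 // => L _; have [->|/dw wL] := eqVneq (w L) 0; first by rewrite mul0r.
rewrite (edeg_eq0 (edegM (@edeg_evec a) (@edeg_ebasis J))) ?mulr0 //.
by rewrite wL add1n eqSS eq_sym.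
Qed.

Lemma edeg1_evec w : edeg 1 w -> w = evec (fun i => w [set i]).
Proof.
move=> dw; apply/ffunP=> J; rewrite ffunE.
have [/eqP/cards1P[i ->]|neJ] := eqVneq #|J| 1%N.
  rewrite (bigD1 i) //= ffunE eqxx mulr1 big1 ?addr0 // => k /negPf neki.
  by rewrite ffunE (inj_eq set1_inj) eq_sym neki mulr0.
rewrite (edeg_eq0 dw neJ) big1 // => i _; rewrite ffunE.
by case: (eqVneq J [set i]) neJ => [->|_ _]; rewrite ?cards1 // mulr0.
Qed.

Lemma edeg2_ind (P : E -> Prop) :
    P 0 -> (forall u w, P u -> P w -> P (u + w)) ->
    (forall c i j, P (c *: (ebasis R [set i] * ebasis R [set j]))) ->
  forall w, edeg 2 w -> P w.
Proof.
move=> P0 PD Pb w dw; rewrite (exterior_basis w); apply: (big_ind P) => // J _.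
have [->|/dw/eqP/cards2P[i [j [neij ->]]]] := eqVneq (w J) 0.
  by rewrite scale0r.
rewrite [ebasis R _](_ : _ = (-1) ^+ below i [set j] *: (ebasis R [set i] * ebasis R [set j])).
  by rewrite scalerA.
by rewrite ebasis1_mul inE (negPf neij) scalerA -expr2 sqrr_sign scale1r.
Qed.

(** A bivector is a sum of products of two vectors, so passing a vector through it
    costs two signs. *)
Lemma edeg2_comm w v : edeg 2 w -> w * evec v = evec v * w.
Proof.
move: w; apply: edeg2_ind => [|u w IHu IHw|c i j].
- by rewrite mulr0 mul0r.
- by rewrite mulrDl mulrDr IHu IHw.
rewrite -scalerAl -scalerAr -!evec_delta; congr (_ *: _).
rewrite -mulrA (evecC (edelta R j) v) mulrN !mulrA (evecC (edelta R i) v).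
by rewrite mulNr opprK.
Qed.

Lemma contr1 a : contr a (1 : E) = 0.
Proof.
apply/ffunP=> J; rewrite contrE exterior0.
rewrite -[1]/(ebasis R set0) epair_ebasisl.
by rewrite (edeg_eq0 (edegM (@edeg_evec a) (@edeg_ebasis J))) // cards0.
Qed.

Lemma contr_evec a v : contr a (evec v) = (\sum_i a i * v i) *: 1.
Proof. by rewrite -[evec v]mulr1 contr_mul contr1 mulr0 subr0. Qed.

(** A bivector is even, so the interior product meets it without a sign. *)
Lemma contr_edeg2_mul a w u : edeg 2 w ->
  contr a (w * u) = contr a w * u + w * contr a u.
Proof.
move: w; apply: edeg2_ind => [|w1 w2 IH1 IH2|c i j].
- by rewrite !(mul0r, contr0) addr0.
- by rewrite mulrDl !contrD IH1 IH2 !mulrDl addrACA.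
rewrite -!scalerAl !contrZ -scalerAl -scalerDr -!evec_delta; congr (_ *: _).
rewrite -mulrA !contr_mul contr_evec mulrBr mulrBl -!scalerAl -!scalerAr mulr1.
by rewrite -scalerAl opprB addrA addrAC mulrA.
Qed.

(** The interior product is a derivation on the commuting elements [w] and [contr a w]. *)
Lemma contr_edeg2_exp a w m : edeg 2 w ->
  contr a (w ^+ m.+1) = m.+1%:R *: (contr a w * w ^+ m).
Proof.
move=> dw; elim: m => [|m IHm]; first by rewrite expr1 expr0 scale1r mulr1.
have [f ef] : exists f, contr a w = evec f.
  by exists (fun i => contr a w [set i]); apply/edeg1_evec/edeg_contr.
rewrite exprS contr_edeg2_mul // IHm ef -scalerAr mulrA edeg2_comm //.
by rewrite -mulrA -exprS -[X in X + _]scale1r -scalerDl nat1r.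
Qed.

Lemma prod_evecC (T : Type) (s : seq T) (al : T -> 'I_n -> R) a :
  \prod_(x <- s) evec (al x) * evec a =
    (-1) ^+ size s *: (evec a * \prod_(x <- s) evec (al x)).
Proof.
elim: s => [|x s IHs]; first by rewrite big_nil mul1r mulr1 scale1r.
rewrite big_cons -mulrA IHs -scalerAr !mulrA [evec (al x) * _]evecC mulNr.
by rewrite exprS mulN1r scaleNr scalerN.
Qed.

Lemma prod_evec_catC (T : Type) (s t : seq T) (al : T -> 'I_n -> R) :
  \prod_(x <- s ++ t) evec (al x) =
    (-1) ^+ (size s * size t) *: \prod_(x <- t ++ s) evec (al x).
Proof.
elim: t => [|y t IHt]; first by rewrite cats0 cat0s muln0 scale1r.
rewrite big_cat big_cons /= mulrA prod_evecC -scalerAl -mulrA -big_cat IHt.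
by rewrite -scalerAr scalerA -exprD -mulnS big_cons.
Qed.

Lemma prod_evec_perm (T : eqType) (s t : seq T) (al : T -> 'I_n -> R) :
    perm_eq s t -> exists k : nat,
  \prod_(x <- s) evec (al x) = (-1) ^+ k *: \prod_(x <- t) evec (al x).
Proof.
move=> st; pose P s := exists k : nat,
   \prod_(x <- s) evec (al x) = (-1) ^+ k *: \prod_(x <- t) evec (al x).
apply: (catCA_perm_ind (P := P) _ (_ : perm_eq t s)); first last.
- by exists 0%N; rewrite scale1r.
- by rewrite perm_sym.
move=> s1 s2 s3 [k eqk]; exists (size s2 * size s1 + k)%N.
rewrite catA big_cat /= prod_evec_catC -scalerAl -big_cat -catA eqk.
by rewrite scalerA -exprD.
Qed.

(** Iterating [contr_mul] over a product of vectors. *)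
Lemma contr_prod (T : Type) (x0 : T) (s : seq T) (al : T -> 'I_n -> R) a :
  contr a (\prod_(x <- s) evec (al x)) =
  \sum_(j < size s) ((-1) ^+ j * \sum_i a i * al (nth x0 s j) i) *:
     \prod_(x <- take j s ++ drop j.+1 s) evec (al x).
Proof.
elim: s => [|y s IHs]; first by rewrite big_nil contr1 big_ord0.
rewrite big_cons contr_mul IHs big_ord_recl /= mul1r drop0; congr (_ + _).
rewrite mulr_sumr -sumrN; apply: eq_bigr => j _.
by rewrite /bump /= big_cons -scalerAr -scaleNr -mulNr exprS mulN1r.
Qed.

End Degree.

(** * Pairing powers of bivectors with decomposable forms; alternating forms *)
Section PowerPairing.
Variables (R : comNzRingType) (n : nat).
Implicit Types (u w : exterior R n) (a b p : 'I_n -> R).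

Lemma epair0l u : epair 0 u = 0.
Proof. by rewrite -(scale0r (0 : exterior R n)) epairZl mul0r. Qed.

Lemma epair1r u : epair u 1 = u set0.
Proof. exact: epair_ebasisr. Qed.

Lemma epair_evec a b : epair (evec a) (evec b) = \sum_i a i * b i.
Proof.
rewrite -[evec b]mulr1 -contr_adj contr_evec epairZl epair1r ffunE eqxx mulr1.
by apply: eq_bigr => i _; rewrite mulrC.
Qed.

Lemma epair_exp0_cons a u : epair (1 : exterior R n) (evec a * u) = 0.
Proof. by rewrite -contr_adj contr1 epair0l. Qed.

Lemma epair_expS_nil w m : edeg 2 w -> epair (w ^+ m.+1) 1 = 0.
Proof.
by move=> dw; rewrite epair1r (edeg_eq0 (@edegX _ _ _ _ m.+1 dw)) // cards0.
Qed.

(** Up to a factorial, the value of a power of [w] on a product of vectors is a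
    Pfaffian; this is its expansion along the first row. *)
Lemma epair_expS_cons (T : Type) (x0 : T) (s : seq T) (al : T -> 'I_n -> R) a w m :
    edeg 2 w ->
  epair (w ^+ m.+1) (evec a * \prod_(x <- s) evec (al x)) =
  m.+1%:R * \sum_(j < size s)
    (-1) ^+ j * epair w (evec a * evec (al (nth x0 s j)))
    * epair (w ^+ m) (\prod_(x <- take j s ++ drop j.+1 s) evec (al x)).
Proof.
move=> dw; rewrite -contr_adj contr_edeg2_exp // epairZl; congr (_ * _).
have [p ep] : exists p, contr a w = evec p.
  by exists (fun i => contr a w [set i]); apply/edeg1_evec/edeg_contr.
rewrite ep epairC -contr_adj (contr_prod x0) epairC epair_sumr.
apply: eq_bigr => j _; rewrite epairZr; congr (_ * _ * _).
by rewrite -contr_adj ep epair_evec.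
Qed.

End PowerPairing.

(** The expansion [epair_expS_cons] expresses the value of [w ^+ m] on a product of
    vectors through the values of [w] on pairs of these vectors.  Bivectors over two
    rings with corresponding values on pairs thus have corresponding powers. *)
Lemma epair_exp_prod_map (R S : comNzRingType) (f : {rmorphism R -> S})
    (n n' : nat) (w : exterior R n) (w' : exterior S n') (T : Type)
    (al : T -> 'I_n -> R) (al' : T -> 'I_n' -> S) :
    edeg 2 w -> edeg 2 w' ->
    (forall x y, f (epair w (evec (al x) * evec (al y))) =
       epair w' (evec (al' x) * evec (al' y))) ->
  forall m s, f (epair (w ^+ m) (\prod_(x <- s) evec (al x))) =
    epair (w' ^+ m) (\prod_(x <- s) evec (al' x)).
Proof.
move=> dw dw' eqf; elim=> [|m IHm] [|x s].
- by rewrite !expr0 !big_nil !epair1r !ffunE rmorph_nat !eqxx.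
- by rewrite !expr0 !big_cons !epair_exp0_cons rmorph0.
- by rewrite !big_nil !epair_expS_nil // rmorph0.
rewrite !big_cons !(epair_expS_cons x) // rmorphM rmorph_nat rmorph_sum.
congr (_ * _); apply: eq_bigr => j _.
by rewrite !rmorphM rmorphXn rmorphN1 eqf IHm.
Qed.

Section Map.
Variables (R S : comNzRingType) (f : {rmorphism R -> S}) (n : nat).
Implicit Types (u w : exterior R n).

Definition emap u : exterior S n := [ffun J => f (u J)].

Lemma emapE u J : emap u J = f (u J).
Proof. by rewrite ffunE. Qed.

Lemma emapM u w : emap (u * w) = emap u * emap w.
Proof.
apply/ffunP=> J; rewrite emapE -!wedgeE !ffunE rmorph_sum.
by apply: eq_bigr => I _; rewrite !rmorphM rmorphXn rmorphN1 !ffunE.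
Qed.

Lemma emap1 : emap 1 = 1.
Proof. by apply/ffunP=> J; rewrite emapE !ffunE rmorph_nat. Qed.

Lemma emapX u m : emap (u ^+ m) = emap u ^+ m.
Proof.
by elim: m => [|m IHm]; rewrite ?expr0 ?emap1 // !exprS emapM IHm.
Qed.

Lemma emap_evec (v : 'I_n -> R) : emap (evec v) = evec (f \o v).
Proof.
apply/ffunP=> J; rewrite emapE !ffunE rmorph_sum.
by apply: eq_bigr => i _; rewrite rmorphM !ffunE rmorph_nat.
Qed.

Lemma emap_prod (T : Type) (s : seq T) (F : T -> exterior R n) :
  emap (\prod_(x <- s) F x) = \prod_(x <- s) emap (F x).
Proof. by apply: (big_morph emap); [exact: emapM|exact: emap1]. Qed.

Lemma epair_emap u w : epair (emap u) (emap w) = f (epair u w).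
Proof.
by rewrite rmorph_sum; apply: eq_bigr => J _; rewrite rmorphM !emapE.
Qed.

Lemma edeg_emap d u : edeg d u -> edeg d (emap u).
Proof.
by move=> du J; rewrite emapE => fu; apply: du; apply: contraNneq fu => ->;
  rewrite rmorph0.
Qed.

End Map.

Section AlternatingForm.
Variables (R : comNzRingType) (n : nat).
Implicit Types (A : 'M[R]_n) (i j k : 'I_n) (v : 'I_n -> R).

Definition set_row A i v : 'M[R]_n :=
  \matrix_(k, m) if k == i then v m else A k m.

Definition row_linear (D : 'M[R]_n -> R) : Prop :=
  forall A i, D A = \sum_j A i j * D (set_row A i (edelta R j)).

Definition row_alternating (D : 'M[R]_n -> R) : Prop :=
  forall A i k, i != k -> A i =1 A k -> D A = 0.

Lemma det_row_linear : row_linear (@determinant R n).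
Proof.
move=> A i; rewrite (expand_det_row _ i); apply: eq_bigr => j _; congr (_ * _).
rewrite (expand_det_row _ i) (bigD1 j) //= big1 ?addr0.
  rewrite mxE eqxx /edelta eqxx mul1r; congr (_ * \det _).
  by apply/matrixP=> x y; rewrite !mxE eq_sym (negPf (neq_lift _ _)).
by move=> k /negPf; rewrite mxE eqxx /edelta eq_sym => ->; rewrite mul0r.
Qed.

Lemma row_linearD D A i (u v : 'I_n -> R) : row_linear D ->
  D (set_row A i (fun j => u j + v j)) = D (set_row A i u) + D (set_row A i v).
Proof.
have set2 w w' : set_row (set_row A i w) i w' = set_row A i w'.
  by apply/matrixP=> x y; rewrite !mxE; case: eqP.
move=> linD; rewrite !(linD (set_row A i _) i) -big_split /=.
by apply: eq_bigr => j _; rewrite !set2 !mxE eqxx mulrDl.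
Qed.

(** Put the sum of the two rows in both places. *)
Lemma row_alternating_swap D A i k : row_linear D -> row_alternating D ->
  i != k -> D (xrow i k A) = - D A.
Proof.
move=> linD altD neik; apply/eqP; rewrite -addr_eq0; apply/eqP.
pose B u v := set_row (set_row A i u) k v.
have alt0 u : D (B u u) = 0.
  by apply: (altD _ _ _ neik) => j; rewrite !mxE eqxx (negPf neik) eqxx.
have setC u v : B u v = set_row (set_row A k v) i u.
  apply/matrixP=> x y; rewrite !mxE; case: (eqVneq x k) => [->|//].
  by rewrite eq_sym (negPf neik).
have := alt0 (fun j => A i j + A k j).
rewrite /B row_linearD // -/(B _ _) -/(B _ _) !setC !row_linearD // -!setC.
rewrite !alt0 add0r addr0 => <-; congr (_ + _); congr D.
  apply/matrixP=> x y; rewrite !mxE.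
  case: (eqVneq x k) => [->|nexk]; first by rewrite tpermR.
  by case: (eqVneq x i) => [->|nexi]; rewrite ?tpermL ?tpermD // eq_sym.
by apply/matrixP=> x y; rewrite !mxE; case: (eqVneq x k) => [->|_] //;
  case: (eqVneq x i) => [->|].
Qed.

(** Expanding the rows one at a time reduces to matrices whose rows are basis vectors.
    Either two rows agree, or the matrix is a permutation matrix, which row swaps
    reduce to the identity. *)
Lemma row_alternating_eq0 D : row_linear D -> row_alternating D ->
  D 1%:M = 0 -> forall A, D A = 0.
Proof.
move=> linD altD D1.
have Dperm (s : 'S_n) : D (perm_mx s) = 0.
  have [ts -> _] := prod_tpermP s; elim: ts => [|t ts IHts].
    by rewrite big_nil perm_mx1.
  rewrite big_cons; have [->|net] := eqVneq t.1 t.2.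
    by rewrite tperm1 mul1g.
  rewrite perm_mxM -row_permE.
  by rewrite -/(xrow _ _ _) row_alternating_swap // IHts oppr0.
suffices Dk (k : nat) A (g : 'I_n -> 'I_n) :
    (forall i, (k <= i)%N -> A i =1 edelta R (g i)) -> D A = 0.
  by move=> A; apply: (Dk n A id) => i; rewrite leqNgt ltn_ord.
elim: k A g => [|k IHk] A g Ag.
  have [injg|] := boolP (injectiveb g); last first.
    case/injectivePn=> i [j neij eqg]; apply: (altD _ _ _ neij) => m.
    by rewrite !Ag // eqg.
  rewrite (_ : A = perm_mx (perm (injectiveP _ injg))) ?Dperm //.
  by apply/matrixP=> i j; rewrite Ag // !mxE permE.
have [ltkn|lenk] := ltnP k n; last first.
  by apply: (IHk A g) => i lek; have := leq_trans lenk lek; rewrite leqNgt ltn_ord.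
rewrite (linD A (Ordinal ltkn)) big1 // => j _.
rewrite (IHk _ (fun i => if i == Ordinal ltkn then j else g i)) ?mulr0 //.
move=> i leki m; rewrite mxE; case: eqP => // /eqP neik; apply: Ag.
by rewrite ltn_neqAle leki andbT eq_sym.
Qed.

(** The difference of both sides is alternating and vanishes at the identity. *)
Lemma row_alternating_det D : row_linear D -> row_alternating D ->
  forall A, D A = \det A * D 1%:M.
Proof.
move=> linD altD A; apply/eqP; rewrite -subr_eq0; apply/eqP.
pose D' A := D A - \det A * D 1%:M.
apply: (@row_alternating_eq0 D') => [B i|B i k neik eqB|]; rewrite /D'.
- rewrite (linD B i) (det_row_linear B i) mulr_suml -sumrB; apply: eq_bigr => j _.
  by rewrite mulrBr mulrA.
- by rewrite (altD _ _ _ neik) // (determinant_alternate neik) // mul0r subr0.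
by rewrite det1 mul1r subrr.
Qed.

End AlternatingForm.

(** * Top coefficients and determinants *)
Section FullCoefficient.
Variables (R : comNzRingType) (n : nat).
Local Notation E := (exterior R n).
Implicit Types (u w : E) (I J : {set 'I_n}) (v : 'I_n -> R) (i j k : 'I_n).

Lemma prod_ebasis_sorted (s : seq 'I_n) : sorted (fun i j : 'I_n => (i < j)%N) s ->
  \prod_(i <- s) ebasis R [set i] = ebasis R [set i in s].
Proof.
elim: s => [|i s IHs] /=; first by rewrite big_nil set_nil.
rewrite path_sortedE; last by move=> x y z; apply: ltn_trans.
case/andP=> /allP lt_is /IHs; rewrite big_cons => ->;
  rewrite ebasis1_mul set_cons inE.
case: ifP => [/lt_is|_]; first by rewrite ltnn.
rewrite /below (_ : [set _ in _ | _] = set0) ?cards0 ?scale1r //.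
apply/setP=> j; rewrite !inE; apply/negbTE/negP=> /andP[/lt_is lt1 lt2].
by have := ltn_trans lt1 lt2; rewrite ltnn.
Qed.

Lemma prod_ebasis_enum J : \prod_(i <- enum J) ebasis R [set i] = ebasis R J.
Proof.
rewrite prod_ebasis_sorted; first by congr ebasis; apply/setP=> i;
  rewrite inE mem_enum.
rewrite {1}/enum_mem; apply: sorted_filter; first by move=> x y z; apply: ltn_trans.
by have := iota_ltn_sorted 0 n; rewrite -val_enum_ord sorted_map -enumT.
Qed.

Lemma prod_row_split A i : exists u w, forall v,
  \prod_k evec ((set_row A i v : 'M[R]_n) k) = u * evec v * w :> E.
Proof.
have := mem_index_enum i; have := index_enum_uniq 'I_n.
set s := index_enum _ => us /splitPr def_s; move: us; case: def_s => s1 s2 us.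
exists (\prod_(k <- s1) evec (A k)), (\prod_(k <- s2) evec (A k)) => v.
have /andP[i1 i2] : (i \notin s1) && (i \notin s2).
  by move: us; rewrite uniq_catC /= mem_cat negb_or => /andP[/andP[-> ->]].
have eqs (r : seq 'I_n) : i \notin r ->
    \prod_(k <- r) evec ((set_row A i v : 'M_n) k) = \prod_(k <- r) evec (A k) :> E.
  move=> ir; rewrite !big_seq; apply: eq_bigr => k kr; apply: eq_evec => m.
  by rewrite mxE; case: eqP kr ir => [-> ->|].
rewrite big_cat big_cons /= !eqs // mulrA; congr (_ * _ * _).
by apply: eq_evec => m; rewrite mxE eqxx.
Qed.

(** Products of vectors are alternating and multilinear, so up to a factor the top
    coefficient is the determinant; the identity matrix fixes the factor. *)
Lemma full_prod_evec (A : 'M[R]_n) :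
  (\prod_(k < n) evec (A k) : E) setT = \det A :> R.
Proof.
pose D A := (\prod_(k < n) evec ((A : 'M_n) k) : E) setT : R.
rewrite -[LHS]/(D A) row_alternating_det.
- suffices -> : D 1%:M = 1 by rewrite mulr1.
  rewrite /D (_ : \prod_(k < n) _ = ebasis R setT) ?ebasisE ?eqxx //.
  rewrite -prod_ebasis_enum enum_setT [index_enum _]unlock; apply: eq_bigr => k _.
  by rewrite -evec_delta; apply: eq_evec => m; rewrite mxE.
- move=> B i; have [u [w uw]] := prod_row_split B i; rewrite /D.
  have -> : \prod_(k < n) evec (B k) = u * evec (B i) * w :> E.
    rewrite -uw; apply: eq_bigr => k _; apply: eq_evec => m; rewrite mxE.
    by case: eqP => [->|].
  rewrite [evec (B i)]evecE mulr_sumr mulr_suml exterior_sum.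
  apply: eq_bigr => j _; rewrite uw evec_delta -scalerAr -scalerAl.
  by rewrite exteriorZ.
move=> B i k neik eqB; rewrite /D.
set s := index_enum _; have ks : k \in s by apply: mem_index_enum.
have is' : i \in rem k s by rewrite mem_rem_uniq ?index_enum_uniq // !inE neik mem_index_enum.
have ps : perm_eq s [:: k, i & rem i (rem k s)].
  by rewrite (perm_trans (perm_to_rem ks)) // perm_cons perm_to_rem.
have [c ->] := prod_evec_perm (fun k => B k) ps.
rewrite !big_cons (eq_evec eqB) [evec _ * (evec _ * _)]mulrA evec_sq mul0r.
by rewrite scaler0 exterior0.
Qed.

(** For lists of length other than [n] both sides vanish, for degree reasons. *)
Lemma full_prod_mulmx (T : Type) (s : seq T) (al : T -> 'I_n -> R) (N : 'M[R]_n) :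
  (\prod_(x <- s) evec (fun j => \sum_i al x i * N i j) : E) setT =
  \det N * (\prod_(x <- s) evec (al x) : E) setT :> R.
Proof.
have [szs|neq_sz] := eqVneq (size s) n; last first.
  by rewrite !(edeg_eq0 (@edeg_prod _ _ _ s _)) ?mulr0 // cardsT card_ord eq_sym.
case: s szs => [|x0 s'] szs.
  rewrite !big_nil; case: _ / szs N => N.
  by rewrite det_mx00 mul1r.
set s := x0 :: s' in szs *.
pose V := \matrix_(k < n, i < n) al (nth x0 s k) i.
have prodE (be : T -> 'I_n -> R) :
    \prod_(x <- s) evec (be x) = \prod_(k < n) evec (be (nth x0 s k)) :> E.
  by rewrite (big_nth x0) szs big_mkord.
rewrite !prodE [RHS]mulrC.
have -> : \prod_(k < n) evec (al (nth x0 s k)) = \prod_(k < n) evec (V k) :> E.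
  by apply: eq_bigr => k _; apply: eq_evec => i; rewrite mxE.
have -> : \prod_(k < n) evec (fun j => \sum_i al (nth x0 s k) i * N i j) =
    \prod_(k < n) evec ((V *m N) k) :> E.
  apply: eq_bigr => k _; apply: eq_evec => i; rewrite mxE.
  by apply: eq_bigr => m _; rewrite mxE.
by rewrite !full_prod_evec det_mulmx.
Qed.

Lemma full_mul_ebasisC u J :
  (u * ebasis R (~: J)) setT = (-1) ^+ inversions J (~: J) * u J :> R.
Proof.
rewrite -wedgeE ffunE (bigD1 J) ?subsetT //= big1 ?addr0 => [|I /andP[_ neIJ]].
  by rewrite setTD ebasisE eqxx mulr1.
by rewrite ebasisE setTD (inj_eq (inv_inj (@setCK _))) (negPf neIJ) mulr0.
Qed.

(** The pairing of complementary degrees given by the top coefficient is perfect. *)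
Lemma full_mul_eq0 u : (forall w, (u * w) setT = 0 :> R) -> u = 0.
Proof.
move=> u0; apply/ffunP=> J; apply/eqP; rewrite exterior0.
have /eqP := u0 (ebasis R (~: J)).
by rewrite full_mul_ebasisC -signr_odd mulr_sign; case: (odd _); rewrite ?oppr_eq0.
Qed.

Lemma epair_div_omega (u w : E) : epair (div_omega u) w = (u * w) setT.
Proof. by rewrite -wedgeE; apply: pairing_div_omega. Qed.

End FullCoefficient.

(** * Rank of a bivector and vanishing of its powers *)
Section Rank.
Variables (L : fieldType) (n : nat).
Local Notation E := (exterior L n).
Implicit Types (u w : E).

Lemma edeg0_scalar u : edeg 0 u -> u = u set0 *: 1.
Proof.
move=> du; apply/ffunP=> J; rewrite exteriorZ -[1]/(ebasis L set0) ebasisE.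
have [->|neJ] := eqVneq J set0; first by rewrite mulr1.
by rewrite mulr0 (edeg_eq0 du) // cards_eq0.
Qed.

(** With [al r] dual to [v r], the equation [evec (v r) * u = 0] yields
    [u = evec (v r) * contr (al r) u];
      the contraction has smaller degree and is still
    annihilated by the other vectors. *)
Lemma annihilator_size k u r (v al : nat -> 'I_n -> L) :
    u != 0 -> edeg k u ->
    (forall i j, (i < r)%N -> (j < r)%N -> \sum_m al i m * v j m = (i == j)%:R) ->
    (forall i, (i < r)%N -> evec (v i) * u = 0) ->
  (r <= k)%N.
Proof.
elim: r k u => // r IHr k u nz_u du dual_v vu0.
have e_u : evec (v r) * contr (al r) u = u.
  have := contr_mul (al r) (v r) u.
  rewrite vu0 // contr0 dual_v // eqxx scale1r => /eqP.
  by rewrite eq_sym subr_eq0 => /eqP.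
have nz_cu : contr (al r) u != 0.
  by apply: contraNneq nz_u => cu0; rewrite -e_u cu0 mulr0.
case: k du => [|k] du.
  by rewrite (edeg0_scalar du) contrZ contr1 scaler0 eqxx in nz_cu.
rewrite ltnS; apply: (IHr _ _ nz_cu (edeg_contr du)).
  by move=> i j ltir ltjr; apply: dual_v; apply: ltnW.
move=> i ltir; have := contr_mul (al r) (v i) u.
rewrite vu0 1?ltnW // contr0 dual_v // 1?ltnW // gtn_eqF // scale0r sub0r.
by move/eqP; rewrite eq_sym oppr_eq0 => /eqP.
Qed.

Definition tensor_mx w : 'M[L]_n :=
  \matrix_(i, j) epair w (evec (edelta L i) * evec (edelta L j)).

Lemma contr_tensor_mx w (a : 'I_n -> L) : edeg 2 w ->
  contr a w = evec (fun j => \sum_i a i * tensor_mx w i j).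
Proof.
move=> dw; rewrite (edeg1_evec (@edeg_contr _ _ _ a _ dw)).
apply: eq_evec => j; rewrite contrE -!evec_delta evecE mulr_suml epair_sumr.
by apply: eq_bigr => i _; rewrite mxE -scalerAl epairZr !evec_delta.
Qed.

(** Let [k] be maximal with [w ^+ k != 0].  Contracting [w ^+ k.+1 = 0] shows that every
    vector in the image of [w] annihilates [w ^+ k], which has degree 2k; by
    [annihilator_size] the image has dimension at most 2k. *)
Lemma exp_eq0_rank w m : [pchar L] =i pred0 -> edeg 2 w -> w ^+ m = 0 ->
  (\rank (tensor_mx w) < m.*2)%N.
Proof.
move=> charL dw wm0.
have ex0 : exists m, w ^+ m == 0 by exists m; apply/eqP.
case: (ex_minnP ex0) => -[|k] /eqP wk0 min_k.
  by have /eqP := wk0; rewrite expr0 oner_eq0.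
have nz_wk : w ^+ k != 0 by apply/negP=> /min_k; rewrite ltnn.
have ltkm : (k < m)%N by apply: min_k; rewrite wm0.
apply: (@leq_ltn_trans k.*2); last by rewrite ltn_double.
set M := tensor_mx w; set V := row_base M.
have kill (a : 'I_n -> L) : evec (fun j => \sum_i a i * M i j) * w ^+ k = 0.
  have /esym/eqP := contr_edeg2_exp a k dw.
  by rewrite wk0 contr0 contr_tensor_mx // scaler_eq0 ((pcharf0P L).1 charL) => /orP[]// /eqP.
have /row_freeP[B VB] : row_free V by apply: row_base_free.
have /submxP[C VC] : (V <= M)%MS by rewrite eq_row_base.
pose ext0 (F : 'I_(\rank M) -> 'I_n -> L) (i : nat) j :=
  if (insub i : option 'I_(\rank M)) is Some o then F o j else 0.
have ext0E F i j (lti : (i < \rank M)%N) : ext0 F i j = F (Ordinal lti) j.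
  by rewrite /ext0 insubT.
rewrite -muln2 mulnC.
apply: (@annihilator_size _ _ _ (ext0 V) (ext0 (fun i j => B j i)) nz_wk).
- exact: edegX.
- move=> i j lti ltj; have /matrixP/(_ (Ordinal ltj) (Ordinal lti)) := VB.
  rewrite !mxE -val_eqE /= eq_sym => <-; apply: eq_bigr => m' _.
  by rewrite !ext0E mulrC.
move=> i lti; rewrite -[RHS](kill (C (Ordinal lti))); congr (_ * _).
by apply: eq_evec => j; rewrite ext0E VC mxE.
Qed.

End Rank.

(** * Differentials of polynomials and algebraic relations *)
Lemma mderiv_var (R : comNzRingType) (n : nat) (i j : 'I_n) :
  ('X_j : {mpoly R[n]})^`M(i) = (j == i)%:R.
Proof.
rewrite mderivX mnm1E; have [->|_] := eqVneq j i; last by rewrite scale0r.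
by rewrite -{1}[U_(i)%MM]add0m addmK mpolyX0 scale1r.
Qed.

Section Composition.
Variables (K : fieldType) (n l : nat).
Local Notation A := {mpoly K[n]}.
Local Notation B := {mpoly K[l]}.
Implicit Types (p q : B) (F G : l.-tuple A) (i : 'I_n) (j : 'I_l).

Lemma mpoly_rmorph_ind (P : B -> Prop) :
    (forall c, P c%:MP) -> (forall j, P 'X_j) ->
    (forall p q, P p -> P q -> P (p + q)) ->
    (forall p q, P p -> P q -> P (p * q)) ->
  forall p, P p.
Proof.
move=> PC PX PD PM p; rewrite (mpolyE p).
apply: (big_ind P _ PD) => [|m _]; first by rewrite -mpolyC0.
rewrite -mul_mpolyC; apply: (PM) => //; rewrite mpolyXE_id.
apply: (big_ind P _ PM) => [|j _]; first by rewrite -mpolyC1.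
by elim: (m j) => [|k IHk]; rewrite ?expr0 ?exprS -?mpolyC1 //; apply: PM.
Qed.

Lemma comp_mpolyM p q F : (p * q) \mPo F = (p \mPo F) * (q \mPo F).
Proof. exact: rmorphM. Qed.

Lemma comp_mpolyX1 j F : 'X_j \mPo F = tnth F j.
Proof. by rewrite comp_mpolyXU -tnth_nth. Qed.

Lemma mderiv_comp p F i :
  (p \mPo F)^`M(i) = \sum_j (p^`M(j) \mPo F) * (tnth F j)^`M(i).
Proof.
elim/mpoly_rmorph_ind: p => [c|j|p q IHp IHq|p q IHp IHq].
- rewrite comp_mpolyC mderivC big1 // => j _.
  by rewrite mderivC comp_mpoly0 mul0r.
- rewrite comp_mpolyX1 (bigD1 j) //= big1 ?addr0 => [|k /negPf nekj].
    by rewrite mderiv_var eqxx comp_mpoly1 mul1r.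
  by rewrite mderiv_var eq_sym nekj comp_mpoly0 mul0r.
- rewrite comp_mpolyD mderivD IHp IHq -big_split; apply: eq_bigr => j _.
  by rewrite mderivD comp_mpolyD mulrDl.
rewrite comp_mpolyM mderivM IHp IHq mulr_suml mulr_sumr -big_split.
apply: eq_bigr => j _; rewrite mderivM comp_mpolyD !comp_mpolyM mulrDl /=.
by rewrite mulrAC mulrA.
Qed.

(** The differential [dform], as an element of the algebra [exterior]. *)
Definition df (f : A) : exterior A n := evec (fun i => f^`M(i)).

Lemma df_comp p F : df (p \mPo F) = \sum_j (p^`M(j) \mPo F) *: df (tnth F j).
Proof.
rewrite /df (eq_evec (mderiv_comp p F)) evec_sum.
by apply: eq_bigr => j _; rewrite evecZ.
Qed.

Lemma df_scale (c : K) f : df (c *: f) = c%:MP *: df f.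
Proof.
by rewrite /df -evecZ; apply: eq_evec => i; rewrite mderivZ mul_mpolyC.
Qed.

Lemma df_var i : df 'X_i = ebasis A [set i].
Proof.
by rewrite -evec_delta; apply: eq_evec => k; rewrite mderiv_var.
Qed.

Lemma exterior_scale_eq0 (R : idomainType) m c (u : exterior R m) :
  c *: u = 0 -> c != 0 -> u = 0.
Proof.
move=> /ffunP cu0 nz_c; apply/ffunP=> J; have /eqP := cu0 J.
by rewrite exteriorZ !exterior0 mulf_eq0 (negPf nz_c) => /eqP.
Qed.

Lemma mderiv_eq0_coef p j (m : 'X_{1..l}) : [pchar K] =i pred0 ->
  p^`M(j) = 0 -> m j != 0%N -> p@_m = 0.
Proof.
move=> charK pj0 nz_mj; have := mcoeff_mderiv j p (m - U_(j)).
rewrite pj0 mcoeff0 submK; last first.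
  by apply/mnm_lepP=> k; rewrite mnm1E; case: eqP => // <-; rewrite lt0n.
move/esym/eqP; rewrite -mulr_natr mulf_eq0 ((pcharf0P K).1 charK) orbF.
by move/eqP.
Qed.

(** In characteristic zero a polynomial with zero derivative in a variable does not
    involve that variable. *)
Lemma comp_mpoly_agree p F G : [pchar K] =i pred0 ->
  (forall j, p^`M(j) = 0 \/ tnth F j = tnth G j) -> p \mPo F = p \mPo G.
Proof.
move=> charK agree; rewrite !comp_mpolyEX; apply: eq_big_seq => m mp.
congr (_ *: _); rewrite !comp_mpolyX; apply: eq_bigr => j _.
have [pj0|->//] := agree j; have [->//|nz_mj] := eqVneq (m j) 0%N.
by rewrite mcoeff_msupp (mderiv_eq0_coef charK pj0 nz_mj) eqxx in mp.
Qed.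

Lemma mderiv_eq0_const p : [pchar K] =i pred0 ->
  (forall j, p^`M(j) = 0) -> p = (p@_0)%:MP.
Proof.
move=> charK p0; apply/mpolyP=> m; rewrite mcoeffC.
have [->|nz_m] := eqVneq m 0%MM; first by rewrite mulr1.
have [j nz_mj] : exists j, m j != 0%N.
  apply/existsP; apply: contraNT nz_m; rewrite negb_exists => /forallP m0.
  by apply/eqP/mnmP=> j; rewrite mnm0E; apply/eqP; have := m0 j; rewrite negbK.
by rewrite mulr0 (mderiv_eq0_coef charK (p0 j) nz_mj).
Qed.

(** Take a relation of least degree: its derivatives have smaller degree. *)
Lemma minimal_relation F : [pchar K] =i pred0 ->
    (exists2 p : B, p != 0 & p \mPo F = 0) ->
  exists p : B, [/\ p != 0, p \mPo F = 0 &
    forall j, p^`M(j) \mPo F = 0 -> p^`M(j) = 0].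
Proof.
move=> charK [p nz_p pF0]; have [k] := ubnP (msize p).
elim: k p nz_p pF0 => // k IHk p nz_p pF0 /ltnSE le_pk.
have [[j [pjF0 nz_pj]]|min_p] := boolp.pselect (exists j, p^`M(j) \mPo F = 0 /\ p^`M(j) <> 0).
  apply: (IHk _ (introN eqP nz_pj) pjF0); apply: leq_trans le_pk.
  rewrite -(mlead_deg (introN eqP nz_pj)).
  have := mlead_supp (introN eqP nz_pj); set m := mlead _.
  rewrite mcoeff_msupp mcoeff_mderiv => nz_c.
  have /msize_mdeg_lt : (m + U_(j))%MM \in msupp p.
    by rewrite mcoeff_msupp; apply: contraNneq nz_c => ->; rewrite mul0rn.
  by rewrite mdegD mdeg1 addn1.
by exists p; split=> // j pjF0; apply: boolp.contrapT => nz_pj; apply: min_p;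
  exists j.
Qed.

(** Differentiate the relation and multiply by [theta]; one term survives. *)
Lemma relation_coef F p j theta : p \mPo F = 0 ->
    (forall k, k != j -> df (tnth F k) * theta = 0) ->
    df (tnth F j) * theta != 0 ->
  p^`M(j) \mPo F = 0.
Proof.
move=> pF0 kill nz; have := df_comp p F; rewrite pF0.
have -> : df 0 = 0.
  by rewrite /df -[RHS](scale0r (evec (fun=> 0))) -evecZ; apply: eq_evec => i;
     rewrite mderiv0 mul0r.
move/(congr1 (fun u => u * theta))/esym; rewrite mul0r mulr_suml (bigD1 j) //=.
rewrite big1 => [|k nekj]; last by rewrite -scalerAl kill ?scaler0.
rewrite addr0 -scalerAl => /exterior_scale_eq0 e0.
by apply/eqP/negP=> /negP/e0/eqP; rewrite (negPf nz).
Qed.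

Lemma evec_mul_prod_mem (R : comNzRingType) m (T : eqType) (s : seq T)
    (al : T -> 'I_m -> R) x :
  x \in s -> evec (al x) * \prod_(y <- s) evec (al y) = 0.
Proof.
move=> /perm_to_rem/(prod_evec_perm al)[k ->].
by rewrite big_cons -scalerAr mulrA evec_sq mul0r scaler0.
Qed.

(** In a relation of least degree every derivative must vanish, by [relation_coef] with
    the product of the other differentials, so the relation is constant. *)
Lemma nonzero_wedge_alg_independent F : [pchar K] =i pred0 ->
  \prod_(j < l) df (tnth F j) != 0 -> alg_independent F.
Proof.
move=> charK nz_w p pF0; apply/eqP/negP=> /negP nz_p.
have [q [nz_q qF0 min_q]] := minimal_relation charK (ex_intro2 _ _ p nz_p pF0).
have dq j : q^`M(j) = 0.
  apply: min_q; set s := index_enum 'I_l.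
  have sj : j \in s by apply: mem_index_enum.
  apply: (@relation_coef _ _ _ (\prod_(k <- rem j s) df (tnth F k))) => //.
    move=> k nekj; apply: (evec_mul_prod_mem (fun k i => (tnth F k)^`M(i))).
    by rewrite mem_rem_uniq ?index_enum_uniq // !inE nekj mem_index_enum.
  apply: contraNneq nz_w => w0.
  have [c ->] := prod_evec_perm (fun k i => (tnth F k)^`M(i)) (perm_to_rem sj).
  by rewrite big_cons [_ * _]w0 scaler0.
have [c eq_q] : exists c, q = c%:MP by exists q@_0; apply: mderiv_eq0_const.
move/eqP: qF0 nz_q; rewrite eq_q comp_mpolyC !mpolyC_eq0 => /eqP->.
by rewrite eqxx.
Qed.

End Composition.

Section MoreComposition.
Variables (K : fieldType).

Lemma comp_mpolyA l n m (p : {mpoly K[l]}) (F : l.-tuple {mpoly K[n]})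
    (G : n.-tuple {mpoly K[m]}) :
  (p \mPo F) \mPo G = p \mPo [tuple tnth F j \mPo G | j < l].
Proof.
elim/mpoly_rmorph_ind: p => [c|j|p q IHp IHq|p q IHp IHq].
- by rewrite !comp_mpolyC.
- by rewrite !comp_mpolyX1 tnth_mktuple.
- by rewrite !comp_mpolyD IHp IHq.
by rewrite !comp_mpolyM IHp IHq.
Qed.

Definition mdeg_le n (p : {mpoly K[n]}) (D : nat) : Prop :=
  forall m : 'X_{1..n}, m \in msupp p -> (mdeg m <= D)%N.

Lemma mdeg_leM n (p q : {mpoly K[n]}) D E :
  mdeg_le p D -> mdeg_le q E -> mdeg_le (p * q) (D + E).
Proof.
move=> dp dq m /msuppM_le/allpairsP[[m1 m2] /= [/dp dm1 /dq dm2 ->]].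
by rewrite mdegD leq_add.
Qed.

Lemma mdeg_le1 n : mdeg_le (1 : {mpoly K[n]}) 0.
Proof. by move=> m; rewrite msupp1 inE => /eqP->; rewrite mdeg0. Qed.

Lemma mdeg_leX n (p : {mpoly K[n]}) D k : mdeg_le p D -> mdeg_le (p ^+ k) (D * k).
Proof.
move=> dp; elim: k => [|k IHk]; first by rewrite muln0; apply: mdeg_le1.
by rewrite exprS mulnS; apply: mdeg_leM.
Qed.

Lemma mdeg_le_prod n (I : finType) (F : I -> {mpoly K[n]}) (D : I -> nat) :
  (forall i, mdeg_le (F i) (D i)) -> mdeg_le (\prod_i F i) (\sum_i D i).
Proof.
move=> dF; elim/big_rec2: _ => [|i D' p _ dp]; first exact: mdeg_le1.
exact: mdeg_leM.
Qed.

(** Among the monomials in the [tnth H j] with exponents below [d], their number d^N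
    exceeds the dimension of the space in which they lie, spanned by the monomials in
    the n variables with exponents below [b], once d is large: b is linear in d. *)
Lemma too_many_alg_dependent n N (H : N.-tuple {mpoly K[n]}) : (n < N)%N ->
  exists2 p : {mpoly K[N]}, p != 0 & p \mPo H = 0.
Proof.
move=> ltnN; pose e := (\max_(j < N) msize (tnth H j)).+1.
(* d is chosen with b ^ n = (N * e) ^ n * d ^ n < d ^ n.+1 <= d ^ N. *)
pose d := ((N * e) ^ n).+1; pose b := (N * d * e)%N.
have e0 : (0 < e)%N by [].
pose Ha (a : {ffun 'I_N -> 'I_d}) := \prod_j tnth H j ^+ a j.
have deg_Ha a (m : 'X_{1..n}) : m \in msupp (Ha a) -> (mdeg m < b)%N.
  have dH j : mdeg_le (tnth H j) e.
    move=> m' /msize_mdeg_lt/ltnW/leq_trans; apply; apply: leqW.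
    exact: (@leq_bigmax _ (fun j => msize (tnth H j)) j).
  move/(mdeg_le_prod (fun j => @mdeg_leX _ _ _ (a j) (dH j)))/leq_ltn_trans; apply.
  apply: (@leq_ltn_trans (\sum_(j < N) e * d.-1)).
    by apply: leq_sum => j _; rewrite leq_mul2l -ltnS ltn_ord orbT.
  rewrite sum_nat_const card_ord /b -mulnA ltn_pmul2l ?(leq_ltn_trans _ ltnN) //.
  by rewrite mulnC ltn_pmul2r.
pose M := \matrix_(x < #|{ffun 'I_N -> 'I_d}|, y < #|{ffun 'I_n -> 'I_b}|)
  (Ha (enum_val x))@_
     [multinom nat_of_ord ((enum_val y : {ffun 'I_n -> 'I_b}) i) | i < n].
have lt_card : (#|{ffun 'I_n -> 'I_b}| < #|{ffun 'I_N -> 'I_d}|)%N.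
  rewrite !card_ffun !card_ord; apply: (@leq_trans (d ^ n.+1)); last first.
    by rewrite leq_pexp2l.
  rewrite /b -mulnA mulnCA expnMn expnS mulnC ltn_pmul2r ?expn_gt0 //.
have : ~~ row_free M.
  rewrite /row_free neq_ltn; apply/orP; left.
  exact: leq_ltn_trans (rank_leq_col _) lt_card.
rewrite -kermx_eq0 => /rowV0Pn[v /sub_kermxP vM nz_v].
pose ex (a : {ffun 'I_N -> 'I_d}) := [multinom nat_of_ord (a j) | j < N].
exists (\sum_x v 0 x *: 'X_[ex (enum_val x)]).
  apply: contraNneq nz_v => p0; apply/eqP/rowP=> x; rewrite mxE.
  have := congr1 (mcoeff (ex (enum_val x))) p0; rewrite mcoeff0 linear_sum.
  rewrite (bigD1 x) //= mcoeffZ mcoeffX eqxx mulr1 big1 ?addr0 // => y neyx.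
  rewrite mcoeffZ mcoeffX; case: eqP => [/mnmP eq_ex|]; last by rewrite mulr0.
  case/eqP: neyx; apply/enum_val_inj/ffunP=> j; apply/val_inj.
  by have := eq_ex j; rewrite !mnmE.
have -> : (\sum_x v 0 x *: 'X_[ex (enum_val x)]) \mPo H = \sum_x v 0 x *: Ha (enum_val x).
  rewrite rmorph_sum; apply: eq_bigr => x _ /=; rewrite comp_mpolyZ comp_mpolyX.
  by congr (_ *: _); apply: eq_bigr => j _; rewrite mnmE.
apply/mpolyP=> m; rewrite mcoeff0 linear_sum /=.
have [lt_mb|le_bm] := ltnP (mdeg m) b; last first.
  rewrite big1 // => x _; rewrite mcoeffZ memN_msupp_eq0 ?mulr0 //.
  by apply: contraL le_bm => /deg_Ha; rewrite -ltnNge.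
have lt_mi i : (m i < b)%N.
  by apply: leq_ltn_trans lt_mb; rewrite mdegE (bigD1 i) //= leq_addr.
have /rowP/(_ (enum_rank [ffun i => Ordinal (lt_mi i)])) := vM.
rewrite !mxE => vMm; rewrite -[RHS]vMm; apply: eq_bigr => x _.
rewrite mcoeffZ mxE; congr (_ * _@_ _); apply/mnmP=> i.
by rewrite mnmE enum_rankK ffunE.
Qed.

End MoreComposition.

(** * The Jacobian criterion *)
Section Jacobian.
Variables (K : fieldType) (n l : nat).
Local Notation A := {mpoly K[n]}.
Implicit Types (F : l.-tuple A).

Lemma exterior_neq0 (R : comNzRingType) m (u : exterior R m) :
  u != 0 -> exists J, u J != 0.
Proof.
move=> nz_u; apply/existsP; apply: contraNT nz_u.
rewrite negb_exists => /forallP u0; apply/eqP/ffunP=> J.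
by rewrite exterior0; apply/eqP; have := u0 J; rewrite negbK.
Qed.

Lemma evec_mul_prod_mul (R : comNzRingType) m (T : Type) (s : seq T)
    (al : T -> 'I_m -> R) a (u : exterior R m) :
  evec a * (\prod_(x <- s) evec (al x) * u) =
    (-1) ^+ size s *: (\prod_(x <- s) evec (al x) * (evec a * u)).
Proof.
rewrite [in RHS]mulrA prod_evecC -scalerAl scalerA -expr2 sqrr_sign scale1r.
by rewrite mulrA.
Qed.

Lemma wedge_zero_first_dependent F : \prod_(j < l) df (tnth F j) = 0 ->
  exists r, [/\ (r < l)%N, \prod_(f <- take r F) df f != 0 &
    \prod_(f <- take r.+1 F) df f = 0].
Proof.
rewrite -(big_tuple _ _ F xpredT (@df K n)) => w0.
have ex0 : exists k, \prod_(f <- take k F) df f == 0.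
  by exists l; rewrite take_oversize ?size_tuple // w0.
case: (ex_minnP ex0) => -[|r] /eqP w0r min_r.
  by have /eqP := w0r; rewrite take0 big_nil oner_eq0.
exists r; split=> //; last by apply/negP=> /min_r; rewrite ltnn.
by apply: min_r; rewrite take_oversize ?size_tuple // w0.
Qed.

(** Let dF_0 /\ ... /\ dF_(r-1) be the last nonzero partial product.  Some n - r variables
    complete it to a nonzero form of top degree.  These variables together with
    F_0, ..., F_r are n + 1 polynomials, hence satisfy a relation.  In a relation of
    least degree the derivative in the place of such a variable x_i vanishes: multiply
    by dF_0 /\ ... /\ dF_(r-1) and the other dx_j, which annihilates dF_r as well.  So the
    relation involves F_0, ..., F_r only. *)
Lemma zero_wedge_alg_dependent F : [pchar K] =i pred0 ->
  \prod_(j < l) df (tnth F j) = 0 -> alg_dependent F.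
Proof.
move=> charK /wedge_zero_first_dependent[r [ltrl nz_w w0]].
set w := \prod_(f <- take r F) df f in nz_w.
have szr : size (take r F) = r by rewrite size_take size_tuple ltrl.
have [J nz_wJ] := exterior_neq0 nz_w.
have cardJ : #|J| = r.
  by rewrite -szr; apply: (@edeg_prod A n _ _ (fun f i => f^`M(i))) nz_wJ.
(* The variables outside J complete the partial product to a form of top degree. *)
have nz_wJC : w * ebasis A (~: J) != 0.
  apply: contraNneq nz_wJ => w0J; have := full_mul_ebasisC w J.
  by rewrite w0J exterior0 => /esym/eqP; rewrite mulf_eq0 signr_eq0.
pose s := take r.+1 F ++ [seq 'X_i | i <- enum (~: J)].
have szr1 : size (take r.+1 F) = r.+1.
  by rewrite size_takel // size_tuple.
have szs : size s == n.+1.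
  have := cardsC J; rewrite card_ord cardJ => def_n.
  by rewrite size_cat szr1 size_map -cardE -[X in _ == X.+1]def_n.
pose H := Tuple szs.
have [P0 nz_P0 P0H] := too_many_alg_dependent H (ltnSn n).
have [P [nz_P PH min_P]] := minimal_relation charK (ex_intro2 _ _ P0 nz_P0 P0H).
have Hle (k : 'I_n.+1) : (k <= r)%N -> tnth H k = nth 0 F k.
  by move=> lekr; rewrite (tnth_nth 0) /= nth_cat szr1 ltnS lekr nth_take.
have Hgt (k : 'I_n.+1) : (r < k)%N -> exists2 i : 'I_n, i \in ~: J &
    tnth H k = 'X_i /\ index i (enum (~: J)) = (k - r.+1)%N.
  move=> ltrk; have lt_sz : (k - r.+1 < size (enum (~: J)))%N.
    have := ltn_ord k; rewrite -{2}(eqP szs) size_cat szr1 size_map.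
    by rewrite ltn_subLR.
  have [i0 _] : exists i0 : 'I_n, true.
    by case: (enum _) lt_sz => // i0; exists i0.
  exists (nth i0 (enum (~: J)) (k - r.+1)); first by rewrite -mem_enum mem_nth.
  split; last by rewrite index_uniq ?enum_uniq.
  by rewrite (tnth_nth 0) /= nth_cat szr1 ltnNge ltrk /= (nth_map i0).
have dP (k : 'I_n.+1) : (r < k)%N -> P^`M(k) = 0.
  move=> ltrk; apply: min_P; have [i iJ [Hk idxi]] := Hgt k ltrk.
  apply: (relation_coef PH (theta := w * ebasis A (~: J :\ i))) => [k' nek'|].
    have [lek'|ltk'] := leqP k' r; last first.
      have [i' i'J [-> idxi']] := Hgt k' ltk'.
      rewrite df_var -evec_delta evec_mul_prod_mul evec_delta ebasis1_mul.
      rewrite !inE; have [ei|nei] := eqVneq i' i.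
        case/eqP: nek'; apply/val_inj => /=.
        by rewrite -(subnK ltk') -(subnK ltrk) -idxi -idxi' ei.
      by move: i'J; rewrite !inE => ->; rewrite mulr0 scaler0.
    rewrite Hle // mulrA; suff -> : df (nth 0 F k') * w = 0 by rewrite mul0r.
    have [ltk'|gek'] := ltnP k' r.
      apply: (evec_mul_prod_mem (fun f i => f^`M(i))).
      by rewrite -(nth_take _ ltk') mem_nth ?szr.
    have ek' : val k' = r by apply/eqP; rewrite eqn_leq lek'.
    have := prod_evecC (take r F) (fun f i => f^`M(i)) (fun i => (nth 0 F k')^`M(i)).
    rewrite -[X in X = _](_ : \prod_(f <- take r.+1 F) df f = _).
      rewrite w0 => /esym/(congr1 (fun u => (-1) ^+ size (take r F) *: u)).
      by rewrite scalerA -expr2 sqrr_sign scale1r scaler0.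
    by rewrite (take_nth 0) ?size_tuple // -cats1 big_cat big_seq1 ek'.
  rewrite Hk df_var -evec_delta evec_mul_prod_mul evec_delta ebasis1_mul.
  rewrite !inE eqxx /= setD1K // -scalerAr scalerA.
  by apply: contra_neq nz_wJC => /exterior_scale_eq0; apply;
    rewrite mulf_neq0 ?signr_eq0.
(* Renaming of the first r + 1 variables, all others going to zero, in both
   directions between the n + 1 variables of the relation and l variables. *)
pose var m (k : nat) : {mpoly K[m]} :=
  oapp (fun o : 'I_m => 'X_o) 0 (if (k <= r)%N then insub k else None).
have varE m k (o : 'I_m) : (k <= r)%N -> val o = k -> var m k = 'X_o.
  by move=> lekr ek; rewrite /var lekr -ek valK.
pose rho := [tuple var l k | k < n.+1]; pose sigma := [tuple var n.+1 k | k < l].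
have lt_l k : (k <= r)%N -> (k < l)%N by move/leq_ltn_trans; apply.
have rho_F (k : 'I_n.+1) : (k <= r)%N -> tnth rho k \mPo F = tnth H k.
  move=> lekr; rewrite tnth_mktuple (varE _ _ (Ordinal (lt_l _ lekr))) //.
  by rewrite comp_mpolyX1 Hle // (tnth_nth 0).
have rho_sigma (k : 'I_n.+1) : (k <= r)%N -> tnth rho k \mPo sigma = 'X_k.
  move=> lekr; rewrite tnth_mktuple (varE _ _ (Ordinal (lt_l _ lekr))) //.
  by rewrite comp_mpolyX1 tnth_mktuple (varE _ _ k).
exists (P \mPo rho); last first.
  rewrite comp_mpolyA -PH; apply: comp_mpoly_agree => // k.
  have [lekr|/dP] := leqP k r; last by left.
  by right; rewrite tnth_mktuple rho_F.
apply: contraNneq nz_P => Q0; apply/eqP.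
suffices -> : P = (P \mPo rho) \mPo sigma by rewrite Q0 comp_mpoly0.
rewrite -[LHS]comp_mpoly_id.
rewrite comp_mpolyA; apply: comp_mpoly_agree => // k.
have [lekr|/dP] := leqP k r; last by left.
by right; rewrite [RHS]tnth_mktuple rho_sigma // tnth_mktuple.
Qed.

End Jacobian.

(** * Unique factorization of polynomials *)
Section Divisibility.
Variable R : idomainType.
Implicit Types (a b c p : R) (s : seq R).

Definition divides a b : Prop := exists c, b = c * a.

Definition prime_element p : Prop :=
  [/\ p != 0, p \isn't a GRing.unit &
      forall a b, divides p (a * b) -> divides p a \/ divides p b].

Definition prime_seq s : Prop := forall p, p \in s -> prime_element p.

Definition has_prime_factorization a : Prop :=
  exists u s, [/\ u \is a GRing.unit, prime_seq s & a = u * \prod_(p <- s) p].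

Lemma divides_mull a b c : divides a b -> divides a (c * b).
Proof. by case=> d ->; exists (c * d); rewrite mulrA. Qed.

Lemma divides_add a b c : divides a b -> divides a c -> divides a (b + c).
Proof. by case=> d -> [e ->]; exists (d + e); rewrite mulrDl. Qed.

Lemma divides_sum a (I : Type) (r : seq I) (P : pred I) (F : I -> R) :
  (forall i, P i -> divides a (F i)) -> divides a (\sum_(i <- r | P i) F i).
Proof.
move=> aF; apply: (big_ind (divides a)) => //; last exact: divides_add.
by exists 0; rewrite mul0r.
Qed.

Lemma prime_seq_cons p s : prime_seq (p :: s) -> prime_element p /\ prime_seq s.
Proof.
by move=> ps; split=> [|q qs]; apply: ps; rewrite inE ?eqxx ?qs ?orbT.
Qed.

Lemma prime_seq_cat s1 s2 : prime_seq s1 -> prime_seq s2 -> prime_seq (s1 ++ s2).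
Proof. by move=> p1 p2 p; rewrite mem_cat => /orP[/p1|/p2]. Qed.

Lemma has_prime_factorizationM a b : has_prime_factorization a ->
  has_prime_factorization b -> has_prime_factorization (a * b).
Proof.
move=> [u [s [uu ps ->]]] [v [t [vu pt ->]]].
exists (u * v), (s ++ t); split; [by rewrite unitrM uu| |].
  exact: prime_seq_cat.
by rewrite big_cat /= mulrACA.
Qed.

Lemma has_prime_factorization_prime p : prime_element p -> has_prime_factorization p.
Proof.
move=> pp; exists 1, [:: p]; split; first exact: unitr1.
  by move=> q; rewrite inE => /eqP->.
by rewrite big_seq1 mul1r.
Qed.

Lemma prime_dvd_prod p s : prime_element p -> divides p (\prod_(q <- s) q) ->
  exists2 q, q \in s & divides p q.
Proof.
case=> _ np pM; elim: s => [|q s IHs]; rewrite ?big_nil ?big_cons.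
  by case=> c /esym c1; case/negP: np; apply/unitrPr; exists c; rewrite mulrC.
case/pM => [pq|/IHs[r rs pr]]; first by exists q; rewrite ?mem_head.
by exists r; rewrite ?inE ?rs ?orbT.
Qed.

Lemma prime_associate p q : prime_element p -> prime_element q -> divides p q ->
  exists2 c, c \is a GRing.unit & q = c * p.
Proof.
move=> [nz_p np _] [nz_q nq qM] [c eq_q]; exists c => //.
have : divides q (c * p) by exists 1; rewrite mul1r.
case/qM => [[d eq_c]|[d eq_p]].
  case/negP: np; apply/unitrPr; exists d; apply: (mulfI nz_q).
  by rewrite mulr1 [RHS]eq_q eq_c; ring.
apply/unitrPr; exists d; apply: (mulIf nz_p).
by rewrite mul1r [RHS]eq_p eq_q; ring.
Qed.

(** Up to a unit, [p] is one of the prime factors of the right side. *)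
Lemma prime_cancel p a u s : prime_element p -> u \is a GRing.unit ->
    prime_seq s -> a * p = u * \prod_(q <- s) q ->
  exists v t, [/\ size s = (size t).+1, v \is a GRing.unit, prime_seq t &
    a = v * \prod_(q <- t) q].
Proof.
move=> pp uu ps eq_ap; have [nz_p np pM] := pp.
have : divides p (u * \prod_(q <- s) q) by exists a.
case/pM => [[c eq_u]|/(prime_dvd_prod pp)[q qs pq]].
  case/negP: np; apply/unitrPr; exists (u^-1 * c).
  by rewrite mulrC -mulrA -eq_u mulVr.
have [c cu eq_q] := prime_associate pp (ps _ qs) pq.
exists (u * c), (rem q s); split.
- by rewrite size_rem // prednK //; case: (s) qs.
- by rewrite unitrM uu.
- by move=> r /mem_rem; apply: ps.
apply: (mulIf nz_p); rewrite eq_ap (perm_big _ (perm_to_rem qs)) big_cons /=.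
by rewrite {1}eq_q !mulrA mulrAC.
Qed.

(** A prime factor of [m] divides all [y * M i] but not all [M i], so it divides [y] and
    can be cancelled from [m] and [y]. *)
Lemma prime_factorization_divides (I : Type) (m : R) (y : R) (M N : I -> R) :
    has_prime_factorization m ->
    (forall q, prime_element q -> exists i, ~ divides q (M i)) ->
    (forall i, m * N i = y * M i) ->
  divides m y.
Proof.
case=> u [s [uu ps ->]] coprM; elim: s ps y => [|p s IHs] ps y eqm.
  by exists (y / u); rewrite big_nil mulr1 divrK.
have [pp {}ps] := prime_seq_cons ps; have [i npM] := coprM p pp.
have [nz_p _ pM] := pp.
have : divides p (y * M i).
  exists (u * \prod_(q <- s) q * N i); rewrite -eqm big_cons.
  by rewrite [p * _]mulrC mulrA mulrAC.
case/pM => [[z eq_y]|//]; have [j|c eq_z] := IHs ps z.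
  apply: (mulIf nz_p); rewrite [RHS]mulrAC -eq_y -eqm big_cons.
  by ring.
by exists c; rewrite eq_y eq_z big_cons [p * _]mulrC !mulrA.
Qed.

End Divisibility.

Definition factorial_ring (R : idomainType) : Prop :=
  forall a : R, a != 0 -> has_prime_factorization a.

Section GaussLemma.
Variable R : idomainType.
Implicit Types (f g h : {poly R}) (p c : R).

Lemma divides_polyC p f : (forall i, divides p f`_i) -> divides p%:P f.
Proof.
move=> pf; rewrite -[f]coefK poly_def; apply: divides_sum => i _.
have [c ->] := pf i; exists (c *: 'X^i).
by rewrite -!mul_polyC polyCM mulrAC.
Qed.

Lemma divides_polyC_coef p f i : divides p%:P f -> divides p f`_i.
Proof. by case=> g ->; exists g`_i; rewrite coefMC. Qed.

(** If [p] divides neither factor, consider the first coefficients it does not divide: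
    [p] does not divide the coefficient of the product in the sum of their degrees. *)
Lemma prime_polyC p : prime_element p -> prime_element p%:P.
Proof.
case=> nz_p np pM; split; first by rewrite polyC_eq0.
  by apply: contra np; rewrite poly_unitE coefC => /andP[].
move=> f g pfg; apply: boolp.contrapT => npfg.
have ndiv h : ~ divides p%:P h -> exists i, ~ divides p h`_i /\
    forall j, (j < i)%N -> divides p h`_j.
  move=> nph; have ex : exists i, ~~ boolp.asbool (divides p h`_i).
    apply: boolp.contrapT => nex; apply: nph; apply: divides_polyC => i.
    by apply: boolp.contrapT => npi; apply: nex; exists i; apply/boolp.asboolPn.
  case: (ex_minnP ex) => i /boolp.asboolPn npi min_i; exists i; split=> // j ltji.
  apply: boolp.contrapT => npj; have := min_i j; rewrite leqNgt ltji.
  by move/(_ (introT (boolp.asboolPn _) npj)).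
have [i [nfi lt_fi]] : exists i, ~ divides p f`_i /\
    forall j, (j < i)%N -> divides p f`_j.
  by apply: ndiv => pf; apply: npfg; left.
have [j [ngj lt_gj]] : exists i, ~ divides p g`_i /\
    forall j, (j < i)%N -> divides p g`_j.
  by apply: ndiv => pg; apply: npfg; right.
have := divides_polyC_coef (i + j) pfg; rewrite coefM.
have lti : (i < (i + j).+1)%N by rewrite ltnS leq_addr.
rewrite (bigD1 (Ordinal lti)) //= addKn => -[c eq_c].
have : divides p (f`_i * g`_j).
  rewrite -(addrK (\sum_(k < (i + j).+1 | k != Ordinal lti) f`_k * g`_(i + j - k)) (_ * _)).
  rewrite eq_c -mulN1r; apply: divides_add; first by exists c.
  apply: divides_mull; apply: divides_sum => k nek.
  have [ltki|leik] := ltnP k i.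
    by rewrite mulrC; apply/divides_mull/lt_fi.
  apply/divides_mull/lt_gj; rewrite ltn_subLR; last by rewrite -ltnS.
  rewrite ltn_add2r ltn_neqAle leik andbT eq_sym.
  by apply: contra nek => /eqP ek; apply/eqP/val_inj.
by case/pM.
Qed.

Lemma prod_polyC_cancel s f g h : prime_seq s ->
    (\prod_(p <- s) p)%:P * f = g * h ->
  exists g' h', [/\ f = g' * h', size g' = size g, size h' = size h &
    (forall p, prime_element p -> ~ divides p%:P g) -> g' = g].
Proof.
elim: s f g h => [|p s IHs] f g h ps.
  by rewrite big_nil mul1r => ->; exists g, h.
have [pp {}ps] := prime_seq_cons ps; rewrite big_cons polyCM => eqf.
have [nz_p _ pM] := prime_polyC pp.
have szp k : size (k * p%:P) = size k.
  by rewrite mulrC mul_polyC size_scale //; case: pp.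
have : divides p%:P (g * h).
  by exists ((\prod_(q <- s) q)%:P * f); rewrite -eqf -mulrA mulrC.
case/pM => [[k eq_g]|[k eq_h]].
  have [|g' [h' [-> szg szh eqg]]] := IHs f k h ps.
    by apply: (mulfI nz_p); rewrite mulrA eqf eq_g; ring.
  exists g', h'; split=> //; first by rewrite szg eq_g szp.
  by move=> /(_ p pp) []; exists k.
have [|g' [h' [-> szg szh eqg]]] := IHs f g k ps.
  by apply: (mulfI nz_p); rewrite mulrA eqf eq_h; ring.
by exists g', h'; split=> //; rewrite szh eq_h szp.
Qed.

Hypothesis facR : factorial_ring R.

(** Each prime factor of [c] divides one of the factors of [g * h], by [prime_polyC]. *)
Lemma scale_cancel c f g h : c != 0 -> c *: f = g * h ->
  exists g' h', [/\ f = g' * h', size g' = size g, size h' = size h &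
    (forall p, prime_element p -> ~ divides p%:P g) -> g' = g].
Proof.
move=> /facR[u [s [uu ps ->]]] eqf.
have szu : size (u^-1 *: h) = size h.
  by rewrite size_scale //; apply: contraTneq (uu) => u0; rewrite -unitrV u0 unitr0.
have := @prod_polyC_cancel s f g (u^-1 *: h) ps; rewrite szu; apply.
by rewrite mul_polyC -scalerAr -eqf !scalerA mulrA mulVr // mul1r.
Qed.

(** Over the fraction field, where [dvdp] lives, an irreducible polynomial is prime;
    denominators are removed by [scale_cancel]. *)
Lemma prime_irreducible_poly f : irreducible_poly f ->
  (forall p, prime_element p -> ~ divides p%:P f) -> prime_element f.
Proof.
move=> irr_f prim_f; have [sz_f irrf] := irr_f.
split; first by rewrite -size_poly_gt0 (ltn_trans _ sz_f).
  by rewrite poly_unitE; apply/nandP; left; rewrite gtn_eqF.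
have dvd a : f %| a -> divides f a.
  case/Pdiv.Idomain.dvdpP=> -[c q] /= nz_c eq_a; rewrite mulrC in eq_a.
  have [g' [h' [eqa _ _ eqg]]] := scale_cancel nz_c eq_a.
  by exists h'; rewrite eqa eqg // mulrC.
move=> a b [c eq_c].
have fab : f %| a * b by rewrite eq_c dvdp_mull.
have [/eqP cop|ncop] := boolP (size (gcdp f a) == 1%N).
  by right; apply: dvd; rewrite Gauss_dvdpr ?coprimep_def ?cop // in fab.
left; apply: dvd; have := irrf _ ncop (dvdp_gcdl f a) => /andP[_ fg].
exact: dvdp_trans fg (dvdp_gcdr f a).
Qed.

(** Each constant prime factor is also one of the leading coefficient, so their number
    is bounded. *)
Lemma strip_content f : f != 0 ->
  exists s f', [/\ prime_seq s, f = (\prod_(p <- s) p)%:P * f' &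
    forall p, prime_element p -> ~ divides p%:P f'].
Proof.
move=> nz_f; have /facR[u [t [uu pt eq_l]]] : lead_coef f != 0.
  by rewrite lead_coef_eq0.
elim: {t}(size t) {-2}t (erefl (size t)) f nz_f u uu pt eq_l => [|k IHk] t szt f nz_f u uu pt eq_l;
have [[p [pp [g eq_f]]]|prim] :=
  boolp.pselect (exists p, prime_element p /\ divides p%:P f);
try by exists [::], f; split=> [q||q pq qf] //;
  [rewrite big_nil mul1r|apply: prim; exists q].
- have := eq_l; rewrite eq_f lead_coefM lead_coefC => eq_l'.
  by have [v [t' []]] := prime_cancel pp uu pt eq_l'; rewrite szt.
have := eq_l; rewrite eq_f lead_coefM lead_coefC => eq_l'.
have [v [t' [szt' vu pt' eq_lg]]] := prime_cancel pp uu pt eq_l'.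
have nz_g : g != 0 by apply: contraNneq nz_f => g0; rewrite eq_f g0 mul0r.
have [|s [f' [ps -> primf']]] := IHk t' _ g nz_g v vu pt' eq_lg.
  by move: szt'; rewrite szt => -[].
exists (p :: s), f'; split=> //.
  by move=> q; rewrite inE => /orP[/eqP->|/ps].
by rewrite big_cons polyCM mulrC mulrA.
Qed.

(** Strip the content; what is left is prime or splits into factors of smaller degree. *)
Lemma factorial_poly : factorial_ring {poly R}.
Proof.
move=> f; have [k] := ubnP (size f).
elim: k f => // k IHk f /ltnSE le_fk nz_f.
have [s [f' [ps eq_f prim]]] := strip_content nz_f.
have facC (t : seq R) : prime_seq t -> has_prime_factorization (\prod_(p <- t) p)%:P.
  move=> pt; exists 1, [seq p%:P | p <- t]; split; first exact: unitr1.
    by move=> q /mapP[p /pt pp ->]; apply: prime_polyC.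
  by rewrite mul1r big_map rmorph_prod.
have nz_f' : f' != 0 by apply: contraNneq nz_f => f0; rewrite eq_f f0 mulr0.
have szf : (size f' <= k)%N.
  apply: leq_trans le_fk; rewrite eq_f mul_polyC size_scale //.
  rewrite prodf_seq_neq0; apply/allP=> p /ps[] //.
rewrite eq_f; apply: has_prime_factorizationM; first exact: facC.
have [sz_le1|sz_gt1] := leqP (size f') 1.
  have := size1_polyC sz_le1; set c := f'`_0 => ef.
  have /facR[u [t [uu pt eq_c]]] : c != 0 by rewrite -polyC_eq0 -ef.
  rewrite ef eq_c polyCM; apply: has_prime_factorizationM (facC t pt).
  by exists u%:P, [::]; rewrite big_nil mulr1; split=> //; apply: rmorph_unit.
have [irr|red] := boolp.pselect (irreducible_poly f').
  exact/has_prime_factorization_prime/prime_irreducible_poly.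
have [q [sz_q q_f neq_q]] : exists q : {poly R}, [/\ size q != 1%N, q %| f' & ~~ (q %= f')].
  apply: boolp.contrapT => nex; apply: red; split=> // q sz_q q_f.
  by apply/negPn/negP => neq; apply: nex; exists q.
have [[c r] /= nz_c eq_r] := Pdiv.Idomain.dvdpP _ _ q_f.
have nz_rq : r * q != 0 by rewrite -eq_r scale_poly_eq0 negb_or nz_c.
have [nz_r nz_q] : r != 0 /\ q != 0.
  by apply/andP; rewrite -negb_or -mulf_eq0.
have szq1 : (1 < size q)%N.
  by rewrite ltn_neqAle eq_sym sz_q size_poly_gt0.
have szqf : (size q < size f')%N.
  by rewrite ltn_neqAle dvdp_leq // andbT dvdp_size_eqp.
have szr : (size r < size f')%N.
  rewrite -(size_scale f' nz_c) eq_r size_mul //.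
  by case: (size q) szq1 => [|[|m]] // _; rewrite !addnS ltnS leq_addr.
have [g [h [-> szg szh _]]] := scale_cancel nz_c eq_r.
apply: has_prime_factorizationM; apply: IHk.
- by rewrite szg (leq_trans szr).
- by rewrite -size_poly_gt0 szg size_poly_gt0.
- by rewrite szh (leq_trans szqf).
by rewrite -size_poly_gt0 szh size_poly_gt0.
Qed.

End GaussLemma.

Section MpolyFactorial.
Variable K : fieldType.

Lemma factorial_field : factorial_ring K.
Proof.
move=> a nz_a; exists a, [::]; rewrite big_nil mulr1 unitfE; split=> //.
Qed.

Lemma factorial_iso (R S : idomainType) (f : {rmorphism R -> S}) :
  bijective f -> factorial_ring S -> factorial_ring R.
Proof.
move=> [g fK gK] facS a nz_a.
have inj_f : injective f := can_inj fK; have inj_g : injective g := can_inj gK.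
have unit_f x : (f x \is a GRing.unit) -> x \is a GRing.unit.
  move/unitrPr=> [y eq1]; apply/unitrPr; exists (g y); apply: inj_f.
  by rewrite rmorphM gK eq1 rmorph1.
have div_f x y : divides (f x) (f y) <-> divides x y.
  split=> [[z eqz]|[z ->]]; last by exists (f z); rewrite rmorphM.
  by exists (g z); apply: inj_f; rewrite rmorphM gK.
have [|u [s [uu ps eq_fa]]] := facS (f a);
  first by rewrite -(rmorph0 f) (inj_eq inj_f).
exists (g u), [seq g p | p <- s]; split.
- by apply: unit_f; rewrite gK.
- move=> _ /mapP[p /ps[nz_p np pM] ->]; split.
  + by apply: contraNneq nz_p => gp0; rewrite -(gK p) gp0 rmorph0.
  + by apply: contra np => gpu; rewrite -(gK p) rmorph_unit.
  move=> x y /div_f; rewrite rmorphM gK => /pM.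
  by case=> dvd; [left|right]; apply/div_f; rewrite gK.
apply: inj_f; rewrite eq_fa rmorphM gK rmorph_prod big_map; congr (_ * _).
by apply: eq_bigr => p _; rewrite gK.
Qed.

Lemma mpoly_rmorph_eq n (S : comNzRingType) (f g : {rmorphism {mpoly K[n]} -> S}) :
  (forall c, f c%:MP = g c%:MP) -> (forall i, f 'X_i = g 'X_i) -> f =1 g.
Proof.
move=> eqC eqX; elim/mpoly_rmorph_ind => // p q eqp eqq.
  by rewrite !rmorphD eqp eqq.
by rewrite !rmorphM eqp eqq.
Qed.

Lemma muni_last n : muni ('X_ord_max : {mpoly K[n.+1]}) = 'X.
Proof.
rewrite /muni mmapX mmap1U; case: splitP => // j /=.
by move/eqP; rewrite gtn_eqF.
Qed.

Lemma muni_widen n (i : 'I_n) :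
  muni ('X_(widen_ord (leqnSn n) i) : {mpoly K[n.+1]}) = ('X_i)%:P.
Proof.
rewrite /muni mmapX mmap1U; case: splitP => [j /= eij|j /= eij].
  by congr ('X_ _)%:P; apply/val_inj.
by have := ltn_ord i; rewrite eij ltnNge leq_addr.
Qed.

(** A polynomial in [n.+1] variables is a polynomial in the last one. *)
Lemma muni_bij n : bijective (@muni n K).
Proof.
pose g : {poly {mpoly K[n]}} -> {mpoly K[n.+1]} :=
  horner_eval 'X_ord_max \o map_poly (@mwiden n K).
have gX : g 'X = 'X_ord_max.
  by rewrite /g /= /horner_eval map_polyX hornerX.
have gC c : g c%:P = mwiden c.
  by rewrite /g /= /horner_eval map_polyC hornerC.
exists g => [p|q].
  apply: (@mpoly_rmorph_eq _ _ (g \o @muni n K) idfun) => [c|i] /=.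
    by rewrite muniC -[LHS]/(g _) gC mwidenC.
  have [lt_in|le_ni] := ltnP i n.
    rewrite (_ : i = widen_ord (leqnSn n) (Ordinal lt_in)); last exact/val_inj.
    by rewrite muni_widen -[LHS]/(g _) gC mwidenX mnmwiden1.
  rewrite (_ : i = ord_max); first by rewrite muni_last -[LHS]/(g _) gX.
  apply/val_inj/eqP.
  by rewrite eqn_leq -ltnS ltn_ord.
have muni_mwiden (c : {mpoly K[n]}) : muni (mwiden c) = c%:P.
  elim/mpoly_rmorph_ind: c => [d|i|c d IHc IHd|c d IHc IHd].
  - by rewrite mwidenC muniC.
  - by rewrite mwidenX mnmwiden1 muni_widen.
  - by rewrite mwidenD muniD polyCD IHc IHd.
  by rewrite mwidenM muniM polyCM IHc IHd.
have gCX c i : g (c%:P * 'X^i) = mwiden c * 'X_ord_max ^+ i.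
  by rewrite /g /= /horner_eval rmorphM /= map_polyC map_polyXn hornerM hornerC hornerXn.
have -> : g q = \sum_(i < size q) mwiden q`_i * 'X_ord_max ^+ i.
  rewrite -[q in LHS]coefK poly_def /g /= !rmorph_sum; apply: eq_bigr => i _.
  by rewrite -mul_polyC; apply: gCX.
rewrite -[RHS]coefK poly_def raddf_sum; apply: eq_bigr => i _.
by rewrite /= muniM muni_mwiden rmorphXn /= muni_last mul_polyC.
Qed.

Lemma factorial_mpoly n : factorial_ring {mpoly K[n]}.
Proof.
elim: n => [|n IHn].
  apply: (@factorial_iso _ K (mcoeff 0%MM) _ factorial_field).
  by exists (@mpolyC 0 K); [exact: mpolyKC|exact: mpolyCK].
exact: factorial_iso (muni_bij n) (factorial_poly IHn).
Qed.

End MpolyFactorial.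

(** * Prime ideals as kernels of points *)
Section PrimeQuotient.
Variables (R : comNzRingType) (I : prime_idealr R).
Local Open Scope quotient_scope.

Definition prime_quotient : Type := {ideal_quot I}.
HB.instance Definition _ := GRing.ComNzRing.on prime_quotient.

Definition prime_quotient_invertible (x : prime_quotient) : Prop := exists y, y * x = 1.
Definition prime_quotient_unit (x : prime_quotient) : bool := boolp.asbool (prime_quotient_invertible x).
(** Invertibility need not be decidable, so the inverse is chosen. *)
Definition prime_quotient_inv (x : prime_quotient) : prime_quotient :=
  if boolp.pselect (prime_quotient_invertible x) is left ex then proj1_sig (boolp.cid ex) else x.

Fact prime_quotient_mulVx : {in prime_quotient_unit, left_inverse 1 prime_quotient_inv *%R}.
Proof.
move=> x /boolp.asboolP ux; rewrite /prime_quotient_inv;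
  case: boolp.pselect => // ex.
by case: boolp.cid.
Qed.

Fact prime_quotient_unitPl (x y : prime_quotient) : y * x = 1 -> prime_quotient_unit x.
Proof. by move=> yx1; apply/boolp.asboolP; exists y. Qed.

Fact prime_quotient_inv_out : {in [predC prime_quotient_unit], prime_quotient_inv =1 id}.
Proof.
by move=> x /boolp.asboolPn nux; rewrite /prime_quotient_inv; case: boolp.pselect.
Qed.

HB.instance Definition _ := GRing.ComNzRing_hasMulInverse.Build prime_quotient
  prime_quotient_mulVx prime_quotient_unitPl prime_quotient_inv_out.

Fact prime_quotient_integral (x y : prime_quotient) : x * y = 0 -> (x == 0) || (y == 0).
Proof. exact: Quotient.rquot_IdomainAxiom. Qed.

HB.instance Definition _ := GRing.ComUnitRing_isIntegral.Build prime_quotient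
  prime_quotient_integral.

HB.instance Definition _ := GRing.RMorphism.copy
  (\pi_{ideal_quot I} : R -> prime_quotient) \pi_{ideal_quot I}.

(** Reduction modulo the ideal, followed by the embedding into the residue field. *)
Definition generic_point : {rmorphism R -> {fraction prime_quotient}} :=
  @tofrac prime_quotient \o (\pi_{ideal_quot I} : R -> prime_quotient).

Lemma generic_point_eq0 a : (generic_point a == 0) = (a \in I).
Proof.
have pi0 : \pi_{ideal_quot I} 0 = 0 :> prime_quotient by apply: rmorph0.
rewrite /= tofrac_eq0 -[a in RHS]subr0 Quotient.idealrBE.
by rewrite -[in LHS]pi0.
Qed.

End PrimeQuotient.

Definition prime_pred (R : comNzRingType) (P : R -> Prop) : Prop :=
  [/\ P 0, forall x y, P x -> P y -> P (x + y), forall a x, P x -> P (a * x),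
      ~ P 1 & forall x y, P (x * y) -> P x \/ P y].

Section PrimePred.
Variables (R : comNzRingType) (P : R -> Prop) (primeP : prime_pred P).

Definition prime_pred_mem of prime_pred P : {pred R} :=
  fun a => boolp.asbool (P a).
Local Notation I := (prime_pred_mem primeP).

Fact prime_pred_idealr : idealr_closed I.
Proof.
have [P0 PD PM P1 _] := primeP; split; [exact/boolp.asboolP| exact/boolp.asboolPn|].
move=> a x y /boolp.asboolP Px /boolp.asboolP Py; apply/boolp.asboolP.
by apply: PD => //; apply: PM.
Qed.

Fact prime_pred_prime_idealr : prime_idealr_closed I.
Proof.
have [_ _ _ _ pP] := primeP => x y /boolp.asboolP/pP.
by case=> Pz; apply/orP; [left|right]; apply/boolp.asboolP.
Qed.

HB.instance Definition _ := isIdealr.Build R I prime_pred_idealr.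
HB.instance Definition _ := isPrimeIdealrClosed.Build R I prime_pred_prime_idealr.

Definition prime_pred_ideal : prime_idealr R := I.

End PrimePred.

Lemma prime_pred_point (K : fieldType) (n : nat) (P : {mpoly K[n]} -> Prop) :
    prime_pred P ->
  exists (L : fieldType) (iota : {rmorphism K -> L}) (xi : 'I_n -> L),
    forall a, P a <-> mmap iota xi a = 0.
Proof.
move=> pP; pose ev := generic_point (prime_pred_ideal pP).
exists {fraction prime_quotient (prime_pred_ideal pP)}, (ev \o @mpolyC n K).
exists (fun i => ev 'X_i) => a.
have -> : mmap (ev \o @mpolyC n K) (fun i => ev 'X_i) a = ev a.
  elim/mpoly_rmorph_ind: a => [c|i|a b IHa IHb|a b IHa IHb].
  - by rewrite mmapC.
  - by rewrite mmapX mmap1U.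
  - by rewrite mmapD rmorphD IHa IHb.
  rewrite (rmorphM ev) -IHa -IHb.
  exact: (rmorphM (mmap (ev \o @mpolyC n K) (fun i => ev 'X_i))).
split=> [Pa|/eqP].
  by apply/eqP; rewrite generic_point_eq0; apply/boolp.asboolP.
by rewrite generic_point_eq0 => /boolp.asboolP.
Qed.

(** * Long chains of primes through the origin *)
Definition prime_chain (R : comNzRingType) (k : nat) (P : nat -> R -> Prop) : Prop :=
  (forall i, (i <= k)%N -> prime_pred (P i)) /\
  (forall i, (i < k)%N ->
     (forall a, P i a -> P i.+1 a) /\ exists a, P i.+1 a /\ ~ P i a).

Lemma prime_pred_preim (R S : comNzRingType) (f : {rmorphism R -> S}) P :
  prime_pred P -> prime_pred (fun a => P (f a)).
Proof.
case=> P0 PD PM P1 pP; split.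
- by rewrite rmorph0.
- by move=> x y Px Py; rewrite rmorphD; apply: PD.
- by move=> a x Px; rewrite rmorphM; apply: PM.
- by rewrite rmorph1.
by move=> x y; rewrite rmorphM => /pP.
Qed.

Lemma prime_chain_preim (R S : comNzRingType) (f : {rmorphism R -> S}) k P :
  (forall y, exists x, f x = y) ->
  prime_chain k P -> prime_chain k (fun i a => P i (f a)).
Proof.
move=> surj_f [pP sP]; split=> i lei; first exact/prime_pred_preim/pP.
have [sPi [a [Pa nPa]]] := sP i lei; split=> [b|]; first exact: sPi.
by have [x fx] := surj_f a; exists x; rewrite fx.
Qed.

Lemma prime_chain_cons (R : comNzRingType) k (P0 : R -> Prop) P :
    prime_pred P0 -> (forall a, P0 a -> P 0%N a) ->
    (exists a, P 0%N a /\ ~ P0 a) ->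
  prime_chain k P -> prime_chain k.+1 (fun i => if i is j.+1 then P j else P0).
Proof.
by move=> pP0 sP0 nP0 [pP sP]; split=> -[|i] // lei; [apply: pP|apply: sP].
Qed.

Lemma prime_pred0 (R : idomainType) : prime_pred (fun a : R => a = 0).
Proof.
split=> //.
- by move=> x y -> ->; rewrite addr0.
- by move=> a x ->; rewrite mulr0.
- by apply/eqP; rewrite oner_eq0.
by move=> x y /eqP; rewrite mulf_eq0 => /orP[]/eqP->; [left|right].
Qed.

Lemma prime_pred_principal (R : idomainType) (p : R) :
  prime_element p -> prime_pred (divides p).
Proof.
case=> nz_p np pM; split.
- by exists 0; rewrite mul0r.
- by move=> x y; apply: divides_add.
- by move=> a x; apply: divides_mull.
- by case=> c /esym c1; case/negP: np; apply/unitrPr; exists c; rewrite mulrC.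
exact: pM.
Qed.

Section Chains.
Variable K : fieldType.

Lemma mcoeff0M n (p q : {mpoly K[n]}) : (p * q)@_0 = p@_0 * q@_0.
Proof. exact: (rmorphM (mcoeff 0%MM)). Qed.

(** The last coordinate is set to zero; for the last index [insub] fails. *)
Definition kill_last n : n.+1.-tuple {mpoly K[n]} :=
  [tuple oapp (fun o : 'I_n => 'X_o) 0 (insub (val i)) | i < n.+1].

Definition restrict_last n : {rmorphism {mpoly K[n.+1]} -> {mpoly K[n]}} :=
  comp_mpoly (kill_last n).

Lemma restrict_last_max n : restrict_last n 'X_ord_max = 0.
Proof. by rewrite /= comp_mpolyX1 tnth_mktuple insubF ?ltnn. Qed.

Lemma restrict_last_surj n y : exists x, restrict_last n x = y.
Proof.
exists (mwiden y); elim/mpoly_rmorph_ind: y => [c|i|a b IHa IHb|a b IHa IHb].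
- by rewrite mwidenC /= comp_mpolyC.
- by rewrite mwidenX mnmwiden1 /= comp_mpolyX1 tnth_mktuple insubT //=.
- by rewrite mwidenD rmorphD IHa IHb.
by rewrite mwidenM rmorphM IHa IHb.
Qed.

Lemma restrict_last_coef0 n p : (restrict_last n p)@_0 = p@_0.
Proof.
elim/mpoly_rmorph_ind: p => [c|i|a b IHa IHb|a b IHa IHb].
- by rewrite /= comp_mpolyC !mcoeffC !eqxx.
- rewrite /= comp_mpolyX1 tnth_mktuple mcoeffX mnm1_eq0.
  by case: insubP => [o _ _|_] /=; rewrite ?mcoeffX ?mnm1_eq0 ?mcoeff0.
- by rewrite rmorphD !mcoeffD IHa IHb.
by rewrite rmorphM !mcoeff0M IHa IHb.
Qed.

(** Ideals generated by more and more variables. *)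
Lemma prime_chain_full n : exists P, @prime_chain {mpoly K[n]} n P.
Proof.
elim: n => [|n [P chP]].
  by exists (fun _ a => a = 0); split=> // i _; apply: prime_pred0.
have := prime_chain_preim (@restrict_last_surj n) chP; set Q := fun _ => _ => chQ.
have Q0 a : restrict_last n a = 0 -> Q 0%N a.
  by move=> a0; rewrite /Q a0; case: chP => /(_ 0%N isT)[].
exists (fun i => if i is j.+1 then Q j else fun a => a = 0).
apply: prime_chain_cons chQ; first exact: prime_pred0.
  by move=> a ->; apply: Q0; rewrite rmorph0.
exists 'X_ord_max; split; first exact/Q0/restrict_last_max.
by move/(congr1 (mcoeff U_(ord_max))); rewrite mcoeffX eqxx mcoeff0 => /eqP;
  rewrite oner_eq0.
Qed.

Lemma prime_factor_coef0 n (q : {mpoly K[n]}) : q != 0 -> q@_0 = 0 ->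
  exists p, [/\ prime_element p, divides p q & p@_0 = 0].
Proof.
move=> /factorial_mpoly[u [s [uu ps ->]]].
have : (u@_0 : K) != 0.
  have := rmorph_unit (mcoeff 0%MM : {rmorphism {mpoly K[n]} -> K}) uu.
  by rewrite unitfE.
rewrite mcoeff0M => nz_u /eqP; rewrite mulf_eq0 (negPf nz_u) /=.
elim: s ps => [|p s IHs] ps; first by rewrite big_nil mcoeffC eqxx mulr1 oner_eq0.
have [pp {}ps] := prime_seq_cons ps.
rewrite big_cons mcoeff0M mulf_eq0 => /orP[/eqP p0|/(IHs ps)].
  exists p; split=> //; exists (u * \prod_(r <- s) r).
  by rewrite [p * _]mulrC mulrA.
case=> r [pr dr r0]; exists r; split=> //.
by rewrite mulrCA; apply: divides_mull.
Qed.

(** Restrict to the hyperplane where the last variable vanishes, and argue by induction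
    on [n].  If [q] restricts to zero, pull back a chain starting at the zero ideal.
    Otherwise replace [q] by a prime factor [p] vanishing at the origin: the chain
    through the restriction of [p] pulls back, and (p) can be put below it, since (p)
    does not contain the last variable: in [X = c * p], comparing the coefficients of
    [X] shows that [c] is not zero at the origin, whereas its restriction must vanish. *)
Lemma prime_chain_through n (q : {mpoly K[n.+1]}) : q@_0 = 0 ->
  exists P, prime_chain n P /\ forall i, (i <= n)%N -> P i q.
Proof.
have zero_case m (r : {mpoly K[m.+1]}) : restrict_last m r = 0 ->
    exists P, prime_chain m P /\ forall i, (i <= m)%N -> P i r.
  move=> r0; have [P chP] := prime_chain_full m.
  exists (fun i a => P i (restrict_last m a)); split.
    exact: prime_chain_preim (@restrict_last_surj m) chP.
  by move=> i lei; rewrite r0; case: chP => /(_ i lei)[].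
elim: n q => [|n IHn] q q0.
  apply: zero_case; rewrite -[LHS]mpolyKC restrict_last_coef0 q0.
  exact: mpolyC0.
have [|nz_rq] := eqVneq (restrict_last _ q) 0; first exact: zero_case.
have nz_q : q != 0 by apply: contraNneq nz_rq => ->; rewrite rmorph0.
have [p [pp pq p0]] := prime_factor_coef0 nz_q q0.
have [|P [chP Pp]] := IHn (restrict_last _ p); first by rewrite restrict_last_coef0.
pose Q i a := P i (restrict_last n.+1 a).
have chQ : prime_chain n Q := prime_chain_preim (@restrict_last_surj _) chP.
exists (fun i => if i is j.+1 then Q j else divides p); split; last first.
  move=> [|i] lei //; have [c ->] := pq; rewrite /Q rmorphM.
  by case: chP => /(_ i lei)[_ _ PM _ _] _; apply/PM/Pp.
apply: prime_chain_cons chQ; first exact: prime_pred_principal.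
  by move=> a [c ->]; rewrite /Q rmorphM; case: chP => /(_ 0%N isT)[_ _ PM _ _] _;
    apply/PM/Pp.
exists 'X_ord_max; split.
  by rewrite /Q restrict_last_max; case: chP => /(_ 0%N isT)[].
case=> c eqX; have nz_rp : restrict_last _ p != 0.
  by apply: contraNneq nz_rq => rp0; have [d ->] := pq; rewrite rmorphM rp0 mulr0.
have := congr1 (fun a => (a^`M(ord_max))@_0) eqX.
rewrite mderiv_var eqxx mderivM mcoeffD !mcoeff0M p0 mulr0 add0r.
have -> : c@_0 = 0.
  rewrite -restrict_last_coef0;
    suffices -> : restrict_last _ c = 0 by rewrite mcoeff0.
  have /esym/eqP := restrict_last_max n.+1; rewrite eqX rmorphM eq_sym mulf_eq0.
  by rewrite (negPf nz_rp) orbF => /eqP.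
by rewrite mul0r mcoeff1 eqxx => /eqP; rewrite oner_eq0.
Qed.

End Chains.

(** * Homogeneous polynomials and forms *)
Section Homogeneous.
Variables (K : fieldType) (n : nat).
Local Notation A := {mpoly K[n]}.
Implicit Types (p q f : A).

(** Components of different degrees have no monomials in common. *)
Lemma dhomog_sum_eq0 (N : nat) (h : nat -> A) (g : nat -> nat) (z : A) (e : nat) :
    (forall k, (k < N)%N -> h k \is (g k).-homog) ->
    {in [pred k | k < N]%N &, injective g} ->
    z \is e.-homog -> \sum_(k < N) h k = z ->
  forall k, (k < N)%N -> g k != e -> h k = 0.
Proof.
move=> hom_h inj_g hom_z sum_h k ltkN ne_gk; apply/eqP/negP=> /negP nz_hk.
have m_in := mlead_supp nz_hk; set m := mlead _ in m_in.
have deg_m : mdeg m = g k := dhomog_mf (hom_h k ltkN) m_in.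
have := congr1 (mcoeff m) sum_h; rewrite raddf_sum (bigD1 (Ordinal ltkN)) //=.
rewrite big1 => [|k' nek']; last first.
  apply: (dhomog_nemf_coeff (hom_h k' (ltn_ord k'))); rewrite /= deg_m.
  by apply: contra nek' => /eqP/inj_g eq_k; apply/eqP/val_inj/esym/eq_k;
    rewrite inE.
rewrite addr0 (dhomog_nemf_coeff hom_z) /= ?deg_m // => /eqP.
by apply/negP; rewrite -mcoeff_msupp.
Qed.

Lemma pihomog_sum p : p = \sum_(k < msize p) pihomog mdeg k p.
Proof. exact: pihomog_partitionE. Qed.

Lemma dhomog_factor p q d e : q != 0 -> q \is d.-homog -> p * q \is e.-homog ->
  p != 0 -> (d <= e)%N /\ p \is (e - d).-homog.
Proof.
move=> nz_q hom_q hom_pq nz_p.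
have pk0 k : (k + d)%N != e -> pihomog mdeg k p = 0.
  move=> nek; have [ltk|gek] := ltnP k (msize p); last first.
    rewrite pihomogE big_seq_cond big1 // => m /andP[/msize_mdeg_lt lt_m /eqP em].
    by have := leq_trans lt_m gek; rewrite em ltnn.
  suffices : pihomog mdeg k p * q = 0.
    by move/eqP; rewrite mulf_eq0 (negPf nz_q) orbF => /eqP.
  apply: (@dhomog_sum_eq0 (msize p) (fun k => pihomog mdeg k p * q) (addn^~ d) (p * q) e) => //.
  - by move=> i _; apply: dhomogM => //; apply: pihomogP.
  - by move=> x y _ _; apply: addIn.
  by rewrite -mulr_suml -pihomog_sum.
have le_de : (d <= e)%N.
  rewrite leqNgt; apply: contra nz_p => lted;
    rewrite (pihomog_sum p) big1 // => k _.
  by apply: pk0; rewrite gtn_eqF // ltn_addl.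
split=> //; rewrite (pihomog_sum p); apply: rpred_sum => k _.
have [<-|nek] := eqVneq (k : nat) (e - d)%N; first exact: pihomogP.
by rewrite pk0 ?rpred0 // -(subnK le_de) eqn_add2r.
Qed.

(** Write [q = c * p].  If [p] does not vanish at the origin, the lowest degree occurring
    in [c] also occurs in [q], so it is [e].  Comparing highest degrees, [p] is constant. *)
Lemma prime_dvd_homog_coef0 p q e : prime_element p -> q != 0 ->
  q \is e.-homog -> divides p q -> p@_0 = 0.
Proof.
move=> [nz_p np _] nz_q hom_q [c eq_q]; apply/eqP/negP=> /negP nz_p0.
have nz_c : c != 0 by apply: contraNneq nz_q => c0; rewrite eq_q c0 mul0r.
set m := mlast c; have mc : m \in msupp c by apply: mlast_supp.
have deg_m : mdeg m = e.
  apply: (dhomog_mf hom_q); rewrite mcoeff_msupp eq_q.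
  rewrite -[p](subrK (p@_0)%:MP) mulrDr mcoeffD [c * _%:MP]mulrC mcoeffCM.
  rewrite [X in X + _](_ : _ = 0) ?add0r.
    by rewrite mulf_neq0 // -mcoeff_msupp.
  apply/eqP; rewrite mcoeff_eq0;
    apply/negP=> /msuppM_le/allpairsP[[m1 m2] /= [m1c m2p eqm]].
  have : (mdeg m <= mdeg m1)%N by apply: lemc_mdeg; apply: mlast_lemc.
  rewrite eqm mdegD -{2}[mdeg m1]addn0 leq_add2l leqn0 mdeg_eq0 => /eqP m20.
  by move: m2p; rewrite m20 mcoeff_msupp mcoeffB mcoeffC eqxx mulr1 subrr eqxx.
have : (mdeg (mlead q) = e)%N := dhomog_mf hom_q (mlead_supp nz_q).
rewrite eq_q mleadM // mdegD => deg_l.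
have : (e <= mdeg (mlead c))%N by rewrite -deg_m;
  apply/lemc_mdeg/mlast_lemc/mlead_supp.
rewrite -deg_l -{2}[mdeg (mlead c)]addn0 leq_add2l leqn0 => /eqP deg0.
have /msize1_polyC ep : (msize p <= 1)%N by rewrite -mlead_deg // deg0.
by case/negP: np; rewrite ep rmorph_unit // unitfE.
Qed.

Lemma euler_homog k p : p \is k.-homog -> \sum_i 'X_i * p^`M(i) = k%:R *: p.
Proof.
move=> hom_p; rewrite {2}(mpolyE p) scaler_sumr.
under eq_bigr do rewrite /mderiv mulr_sumr.
rewrite exchange_big; apply: eq_big_seq => m mp /=.
have em : mdeg m = k := dhomog_mf hom_p mp.
rewrite -em mdegE natr_sum scaler_suml; apply: eq_bigr => i _.
rewrite -scalerAr -scalerA; have [->|nz_mi] := eqVneq (m i) 0%N;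
  first by rewrite !scale0r.
by rewrite -mpolyXD addmC submK //; apply/mnm_lepP=> j; rewrite mnm1E;
  case: eqP => // <-; rewrite lt0n.
Qed.

Definition form_homog d (u : exterior A n) : Prop := forall J, u J \is d.-homog.

Lemma form_homogM d e u w : form_homog d u -> form_homog e w -> form_homog (d + e) (u * w).
Proof.
move=> hu hw J; rewrite -wedgeE ffunE; apply: rpred_sum => I _.
have sgn k (x : A) m : x \is m.-homog -> (-1) ^+ k * x \is m.-homog.
  by rewrite -signr_odd mulr_sign; case: odd; rewrite ?dhomogN.
by rewrite -mulrA; apply/sgn/dhomogM.
Qed.

Lemma form_homog1 : form_homog 0 1.
Proof.
by move=> J; rewrite ffunE; case: eqP => _; rewrite ?rpred0 // dhomog1.
Qed.

Lemma mderiv_homog k p i : p \is k.-homog -> p^`M(i) \is k.-1.-homog.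
Proof.
move=> hom_p; rewrite /mderiv big_seq; apply: rpred_sum => m mp.
have [->|nz_mi] := eqVneq (m i) 0%N; first by rewrite mul0r scale0r rpred0.
apply: dhomogZ; rewrite dhomogX /=; have em : mdeg m = k := dhomog_mf hom_p mp.
apply/eqP; rewrite -em -[in RHS](@submK _ U_(i) m) ?mdegD ?mdeg1 ?addn1 //.
by apply/mnm_lepP=> j; rewrite mnm1E; case: eqP => // <-; rewrite lt0n.
Qed.

Lemma df_homog k p : p \is k.-homog -> form_homog k.-1 (df p).
Proof.
move=> hom_p J; rewrite ffunE; apply: rpred_sum => i _.
rewrite ffunE; case: eqP => _; rewrite ?mulr1 ?mulr0 ?rpred0 //.
exact: mderiv_homog.
Qed.

Lemma prod_df_homog (s : seq A) : (forall f, f \in s -> exists k, f \is k.-homog) ->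
  exists k, form_homog k (\prod_(f <- s) df f).
Proof.
elim: s => [|f s IHs] hs; first by exists 0%N; rewrite big_nil; apply: form_homog1.
have [k hk] := hs f (mem_head _ _); have [|m hm] := IHs.
  by move=> g gs; apply: hs; rewrite inE gs orbT.
by exists (k.-1 + m)%N; rewrite big_cons; apply: form_homogM (df_homog hk) hm.
Qed.

Lemma df_add f g : df (f + g) = df f + df g.
Proof.
have := evec_linear 1 (fun i => f^`M(i)) (fun i => g^`M(i)); rewrite scale1r => <-.
by apply: eq_evec => i; rewrite mderivD mul1r.
Qed.

Lemma df_mul f g : df (f * g) = g *: df f + f *: df g.
Proof.
have := evec_linear g (fun i => f^`M(i)) (fun i => f * g^`M(i)).
by rewrite evecZ => <-; apply: eq_evec => i; rewrite mderivM [_ * g]mulrC.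
Qed.

Lemma df0 : df 0 = 0 :> exterior A n.
Proof.
have := evecZ 0 (fun i : 'I_n => (0 : A)); rewrite scale0r => <-.
by apply: eq_evec => i; rewrite mderiv0 mul0r.
Qed.

Lemma df_sum (I : Type) (s : seq I) (P : pred I) (F : I -> A) :
  df (\sum_(i <- s | P i) F i) = \sum_(i <- s | P i) df (F i).
Proof.
exact: (big_morph _ df_add df0).
Qed.

(** The exterior derivative of the form with coefficients [v]. *)
Definition d_oneform (v : 'I_n -> A) : exterior A n := \sum_i df (v i) * ebasis A [set i].

(** Second derivatives commute, so the sum equals its own opposite. *)
Lemma d_oneform_df f : [pchar K] =i pred0 -> d_oneform (fun i => f^`M(i)) = 0.
Proof.
move=> charK; set S := d_oneform _.
have eS : S = - S.
  rewrite /S /d_oneform -sumrN; under eq_bigr do rewrite /df evecE mulr_suml.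
  rewrite [LHS]exchange_big; apply: eq_bigr => i _ /=.
  rewrite /df evecE mulr_suml -sumrN; apply: eq_bigr => j _.
  rewrite -[LHS]scalerAl -[X in _ = - X]scalerAl mderiv_comm -scalerN.
  by congr (_ *: _); apply: ebasis1_mulC.
have : (2%:R : A) *: S = 0 by rewrite scaler_nat mulr2n {1}eS addNr.
move/exterior_scale_eq0; apply.
by rewrite -mpolyC_nat mpolyC_eq0 ((pcharf0P K).1 charK).
Qed.

Lemma d_oneform_sum_scale (I : finType) (c : I -> A) (v : I -> 'I_n -> A) :
  d_oneform (fun i => \sum_j c j * v j i) =
  \sum_j (df (c j) * evec (v j) + c j *: d_oneform (v j)).
Proof.
have step i : df (\sum_j c j * v j i) * ebasis A [set i] =
    \sum_j (df (c j) * (v j i *: ebasis A [set i]) + c j *: (df (v j i) * ebasis A [set i])).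
  rewrite df_sum mulr_suml; apply: eq_bigr => j _.
  rewrite df_mul [LHS]mulrDl -[X in X + _ = _]scalerAl -[X in _ + X = _]scalerAl.
  by rewrite -[X in _ = X + _]scalerAr.
rewrite /d_oneform (eq_bigr _ (fun i _ => step i)) exchange_big.
apply: eq_bigr => j _; rewrite big_split /= evecE.
by rewrite -mulr_sumr -scaler_sumr.
Qed.

End Homogeneous.

(** * Polynomials with differential in the span of given ones *)
Section OneMoreVector.
Variables (R : comNzRingType) (n : nat).
Implicit Types (v : 'I_n -> R).

Lemma edelta_dot m v : \sum_i edelta R m i * v i = v m.
Proof.
rewrite (bigD1 m) //= /edelta eqxx mul1r big1 ?addr0 // => i /negPf nei.
by rewrite eq_sym nei mul0r.
Qed.

Lemma evec_coef v m : evec v [set m] = v m.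
Proof. by rewrite -epair_ebasisl -evec_delta epair_evec edelta_dot. Qed.

Variables (T : eqType) (x0 : T) (s : seq T) (al : T -> 'I_n -> R).
Implicit Types (x : T) (I : {set 'I_n}).

Definition omit_prod (j : nat) : exterior R n :=
  \prod_(y <- take j s ++ drop j.+1 s) evec (al y).
Local Notation w := (\prod_(y <- s) evec (al y)).

Lemma evec_mul_omit j : (j < size s)%N ->
  evec (al (nth x0 s j)) * omit_prod j = (-1) ^+ j *: w.
Proof.
move=> ltj; rewrite /omit_prod -[s in RHS](cat_take_drop j) (drop_nth x0 ltj).
rewrite !big_cat big_cons /= [in RHS]mulrA prod_evecC.
by rewrite size_takel ?(ltnW ltj) // -scalerAl scalerA -expr2 sqrr_sign scale1r mulrA.
Qed.

Lemma evec_mul_omit_neq j k : (k < size s)%N -> k != j ->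
  evec (al (nth x0 s k)) * omit_prod j = 0.
Proof.
move=> ltk nekj; apply: evec_mul_prod_mem; rewrite mem_cat.
have [ltkj|ltjk|ekj] := ltngtP k j; last by rewrite ekj eqxx in nekj.
  rewrite -(nth_take _ ltkj) mem_nth // size_take.
  by case: (ltnP j (size s)).
apply/orP; right; rewrite -(subnKC ltjk) -nth_drop mem_nth // size_drop.
by rewrite ltn_sub2r // (leq_ltn_trans ltjk).
Qed.

(** The coordinates of [evec (al x)] on the vectors of [s], multiplied by the common
    denominator [w I], according to Cramer's rule. *)
Definition cramer_coef x j I : R := (-1) ^+ j * (evec (al x) * omit_prod j) I.

(** Contract the vanishing product of [x] and [s] with the coordinate vectors. *)
Lemma cramer_omit x I : evec (al x) * w = 0 ->
  w I *: evec (al x) =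
  \sum_(j < size s) cramer_coef x j I *: evec (al (nth x0 s j)).
Proof.
move=> xs0; rewrite -evecZ; under [RHS]eq_bigr do rewrite -evecZ.
rewrite -evec_sum; apply: eq_evec => m.
have := congr1 (fun u : exterior R n => u I) (contr_prod x0 (x :: s) al (edelta R m)).
rewrite big_cons xs0 contr0 exterior0 exterior_sum /= big_ord_recl /=.
rewrite edelta_dot exteriorZ expr0 mul1r drop0 => /esym/eqP.
rewrite addr_eq0 => /eqP; rewrite mulrC => ->; rewrite -sumrN.
apply: eq_bigr => j _; rewrite exteriorZ edelta_dot big_cons /cramer_coef.
by rewrite /bump /= exprS mulN1r !mulNr opprK mulrAC.
Qed.

(** Multiply [cramer_omit] by the product of all vectors but the j-th. *)
Lemma cramer_coef_proportional x I I' j : (j < size s)%N -> evec (al x) * w = 0 ->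
  w I * cramer_coef x j I' = cramer_coef x j I * w I'.
Proof.
move=> ltj /(cramer_omit I)/(congr1 (fun u : exterior R n => (u * omit_prod j) I')).
rewrite mulr_suml (bigD1 (Ordinal ltj)) //= [X in _ + X]big1 => [|k nekj];
  last first.
  by rewrite -scalerAl evec_mul_omit_neq ?scaler0.
rewrite addr0 -!scalerAl evec_mul_omit // !exteriorZ => eqw.
rewrite {1}/cramer_coef mulrCA eqw mulrCA; congr (_ * _).
by rewrite mulrA -expr2 sqrr_sign mul1r.
Qed.

End OneMoreVector.

Lemma cramer_quotient (R : idomainType) n (T : eqType) (x0 x : T) (s : seq T)
    (al : T -> 'I_n -> R) I (c : 'I_(size s) -> R) :
    (\prod_(y <- s) evec (al y)) I != 0 ->
    evec (al x) * \prod_(y <- s) evec (al y) = 0 ->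
    (forall j : 'I_(size s), cramer_coef s al x j I = c j * (\prod_(y <- s) evec (al y)) I) ->
  evec (al x) = \sum_(j < size s) c j *: evec (al (nth x0 s j)).
Proof.
set w := \prod_(y <- s) _ => nz_wI xs0 eq_c.
apply/eqP; rewrite -subr_eq0; apply/eqP;
  apply: (exterior_scale_eq0 (c := w I)) => //.
rewrite scalerBr (cramer_omit x0 I xs0) scaler_sumr -sumrB big1 // => j _.
by rewrite eq_c scalerA [w I * _]mulrC subrr.
Qed.

Lemma df_combination (K : fieldType) n (I : finType) (a : {mpoly K[n]})
    (c f : I -> {mpoly K[n]}) : df a = \sum_j c j *: df (f j) ->
  forall m, a^`M(m) = \sum_j c j * (f j)^`M(m).
Proof.
move=> eq_a m; rewrite -(evec_coef (fun i => a^`M(i))) [evec _]eq_a exterior_sum.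
by apply: eq_bigr => j _; rewrite exteriorZ evec_coef.
Qed.

Section Generation.
Variables (K : fieldType) (charK : [pchar K] =i pred0) (n l : nat).
Local Notation A := {mpoly K[n]}.
Variable F : l.-tuple A.
Implicit Types (a f : A) (I : {set 'I_n}).

Definition total_wedge : exterior A n := \prod_(f <- F) df f.
Definition omit_wedge (j : nat) : exterior A n := omit_prod F (fun f i => f^`M(i)) j.
Local Notation w := total_wedge.
Definition cramer a (j : nat) I : A := cramer_coef F (fun f i => f^`M(i)) a j I.

Lemma df_mul_omit (j : 'I_l) : df (tnth F j) * omit_wedge j = (-1) ^+ j *: w.
Proof. by rewrite (tnth_nth 0); apply: evec_mul_omit;
  rewrite size_tuple ltn_ord. Qed.

Lemma df_mul_omit_neq (j k : 'I_l) : k != j -> df (tnth F k) * omit_wedge j = 0.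
Proof. by rewrite (tnth_nth 0); apply: evec_mul_omit_neq;
  rewrite size_tuple ltn_ord. Qed.

Hypothesis w_primitive :
  forall q : A, prime_element q -> exists I, ~ divides q (w I).

(** By [cramer_coef_proportional] the fraction [cramer a j I / w I] does not depend on [I];
    as the [w I] have no common prime factor, its denominator is a unit. *)
Lemma df_integral_span a I : w I != 0 -> df a * w = 0 ->
  exists c : 'I_l -> A,
    (forall j, c j * w I = cramer a j I) /\
    df a = \sum_j c j *: df (tnth F j).
Proof.
move=> nz_wI aw0.
have dvd (j : 'I_l) : divides (w I) (cramer a j I).
  apply: (prime_factorization_divides (M := fun I => w I)
    (N := fun I => cramer a j I)); [exact: factorial_mpoly|exact: w_primitive|].
  by move=> I'; apply: cramer_coef_proportional => //; rewrite size_tuple ltn_ord.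
have [c eq_c] := boolp.choice dvd; exists c; split=> [j|]; first by rewrite eq_c.
have szF := size_tuple F; pose c' j := c (cast_ord szF j).
have span := @cramer_quotient A n _ 0 a F (fun f i => f^`M(i)) I c' nz_wI aw0.
rewrite /df span => [|j]; last by rewrite -eq_c.
rewrite (reindex (cast_ord (esym szF))) /=.
  by apply: eq_bigr => j _; rewrite /c' cast_ordKV (tnth_nth 0).
by exists (cast_ord szF) => j _; [apply: cast_ordKV|apply: cast_ordK].
Qed.

(** The exterior derivative of the equation is [0 = \sum_j df (c j) * df (tnth F j)];
    multiply by the product of all [df (tnth F k)] with [k != j]. *)
Lemma span_coef_closed a (c : 'I_l -> A) : df a = \sum_j c j *: df (tnth F j) ->
  forall j, df (c j) * w = 0.
Proof.
move=> eq_a j.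
have eqv := df_combination eq_a.
have := d_oneform_df a charK; rewrite /d_oneform; under eq_bigr do rewrite eqv.
rewrite -/(d_oneform (fun m => \sum_k c k * (tnth F k)^`M(m))).
rewrite (d_oneform_sum_scale c (fun k m => (tnth F k)^`M(m))) => d0.
have {d0} : \sum_k df (c k) * df (tnth F k) = 0.
  rewrite -[RHS]d0; apply: eq_bigr => k _.
  by rewrite (d_oneform_df _ charK) scaler0 addr0.
move/(congr1 (fun u => u * omit_wedge j)); rewrite mul0r mulr_suml (bigD1 j) //=.
rewrite big1 => [|k nekj]; last by rewrite -mulrA df_mul_omit_neq ?mulr0.
rewrite addr0 -mulrA df_mul_omit -scalerAr => /exterior_scale_eq0; apply.
by rewrite signr_eq0.
Qed.

End Generation.

Lemma df_pihomog0 (K : fieldType) n (a : {mpoly K[n]}) :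
  df (pihomog mdeg 0 a) = 0.
Proof.
have /msize1_polyC -> : (msize (pihomog mdeg 0 a) <= 1)%N.
  rewrite msizeE; apply/bigmax_leqP_seq => m ma _.
  by rewrite (dhomog_mf (pihomogP _ _ _) ma : mdeg m = 0%N).
by rewrite -df0; apply: eq_evec => i; rewrite mderivC mderiv0.
Qed.

Section HomogeneousGeneration.
Variables (K : fieldType) (charK : [pchar K] =i pred0) (n l : nat).
Local Notation A := {mpoly K[n]}.
Variable F : l.-tuple A.
Local Notation w := (total_wedge F).
Hypothesis F_homog : forall j, exists k, tnth F j \is k.-homog.
Hypothesis w_neq0 : w != 0.
Hypothesis w_primitive :
  forall q : A, prime_element q -> exists I, ~ divides q (w I).

Lemma total_wedge_homog : exists e, form_homog e w.
Proof.
apply: prod_df_homog => f /tnthP[j ->]; exact: F_homog.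
Qed.

Lemma omit_wedge_homog j : exists e, form_homog e (omit_wedge F j).
Proof.
apply: prod_df_homog => f; rewrite mem_cat => f_in.
have /tnthP[k ->] : f \in F by case/orP: f_in => [/mem_take|/mem_drop].
exact: F_homog.
Qed.

(** Induction on [k]: the coefficients of [df a] on the [df (tnth F j)] have degree less
    than [k], and Euler's formula recovers [a] from them. *)
Lemma homog_generated k a : a \is k.-homog -> df a * w = 0 ->
  exists P : {mpoly K[l]}, a = P \mPo F.
Proof.
elim/ltn_ind: k a => k IHk a hom_a aw0.
have [k0|k_gt0] := posnP k.
  exists (a@_0)%:MP; rewrite comp_mpolyC; apply/msize1_polyC.
  rewrite msizeE; apply/bigmax_leqP_seq => m ma _.
  by rewrite (dhomog_mf hom_a ma : mdeg m = k) k0.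
have [I nz_wI] := exterior_neq0 w_neq0.
have [c [eq_c eq_a]] := df_integral_span w_primitive nz_wI aw0.
have cw0 := span_coef_closed charK eq_a.
have c_gen j : exists P : {mpoly K[l]}, c j = P \mPo F.
  have [->|nz_cj] := eqVneq (c j) 0; first by exists 0; rewrite comp_mpoly0.
  have [e hom_w] := total_wedge_homog; have [ej hom_o] := omit_wedge_homog j.
  have [fj hom_F] := F_homog j.
  have eq_e : e = (fj.-1 + ej)%N.
    apply: (dhomog_uniq nz_wI (hom_w I)).
    have := form_homogM (df_homog hom_F) hom_o I.
    by rewrite df_mul_omit exteriorZ -signr_odd mulr_sign; case: odd;
      rewrite ?dhomogN.
  have hom_N : c j * w I \is (k.-1 + ej).-homog.
    rewrite eq_c /cramer /cramer_coef -signr_odd mulr_sign.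
    by have := form_homogM (df_homog hom_a) hom_o I; case: odd; rewrite ?dhomogN.
  have [_ hom_c] := dhomog_factor nz_wI (hom_w I) hom_N nz_cj.
  apply: (IHk _ _ _ hom_c (cw0 j)).
  rewrite eq_e subnDr; apply: leq_ltn_trans (leq_subr _ _) _.
  by rewrite prednK.
have [P eq_P] := boolp.choice c_gen; have [f hom_f] := boolp.choice F_homog.
exists (\sum_j ((f j)%:R / k%:R) *: (P j * 'X_j)).
have nz_k : (k%:R : K) != 0 by rewrite ((pcharf0P K).1 charK) -lt0n.
apply: (scalerI nz_k); rewrite -(euler_homog hom_a).
have -> : \sum_i 'X_i * a^`M(i) = \sum_j (f j)%:R *: (c j * tnth F j).
  under eq_bigr do rewrite (df_combination eq_a) mulr_sumr.
  rewrite exchange_big; apply: eq_bigr => j _ /=.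
  rewrite scalerAr -(euler_homog (hom_f j)) mulr_sumr.
  by apply: eq_bigr => i _; rewrite mulrCA.
rewrite rmorph_sum scaler_sumr; apply: eq_bigr => j _ /=.
rewrite comp_mpolyZ comp_mpolyM comp_mpolyX1 -eq_P scalerA.
by rewrite mulrCA mulfV // mulr1.
Qed.

(** The equation is homogeneous, so it holds for the components of [a]. *)
Lemma wedge_closed_generated a : df a * w = 0 ->
  exists P : {mpoly K[l]}, a = P \mPo F.
Proof.
move=> aw0; have [e hom_w] := total_wedge_homog.
have gen k : exists P : {mpoly K[l]}, pihomog mdeg k a = P \mPo F.
  apply: (@homog_generated k); first exact: pihomogP.
  case: k => [|k].
    by rewrite df_pihomog0 mul0r.
  have [ltk|gek] := ltnP k.+1 (msize a); last first.
    rewrite (_ : pihomog _ _ _ = 0) ?df0 ?mul0r //.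
    rewrite pihomogE big_seq_cond big1 // => m /andP[/msize_mdeg_lt lt_m /eqP em].
    by have := leq_trans lt_m gek; rewrite em ltnn.
  apply/ffunP=> I; rewrite exterior0.
  pose h k := (df (pihomog mdeg k.+1 a) * w) I : {mpoly K[n]}.
  apply: (@dhomog_sum_eq0 _ _ (msize a).-1 h (fun k => k + e)%N 0 (k + e).+1).
  - by move=> i _; apply: form_homogM (df_homog (pihomogP _ _ _)) hom_w I.
  - by move=> x y _ _; apply: addIn.
  - exact: rpred0.
  - have := congr1 (fun u : exterior _ n => u I) aw0.
    rewrite {1}(pihomog_sum a) df_sum mulr_suml exterior_sum exterior0.
    case: (msize a) ltk => // N _; rewrite big_ord_recl /= df_pihomog0 mul0r.
    by rewrite exterior0 add0r.
  - by case: (msize a) ltk.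
  by rewrite ltn_eqF.
have [P eq_P] := boolp.choice gen; exists (\sum_(k < msize a) P k).
by rewrite rmorph_sum {1}(pihomog_sum a); apply: eq_bigr => k _; rewrite /= eq_P.
Qed.

End HomogeneousGeneration.

(** * Poisson tensors: rank, centre, singular locus *)
Lemma prime_chain_coef0 (K : fieldType) n (q : {mpoly K[n]}) :
    prime_element q -> q@_0 = 0 ->
  (0 < n)%N /\ exists P, prime_chain n.-1 P /\ forall i, (i <= n.-1)%N -> P i q.
Proof.
case: n q => [|n] q [nz_q _ _] q0; last by split=> //; apply: prime_chain_through.
by rewrite -[q]mpolyKC q0 mpolyC0 eqxx in nz_q.
Qed.

Section Tensors.
Variables (K : fieldType) (charK : [pchar K] =i pred0) (n : nat).
Local Notation A := {mpoly K[n]}.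
Implicit Types (w : exterior A n) (f g : A).

Lemma tensor_bracketE w f g : tensor_bracket w f g = epair w (df f * df g).
Proof. by rewrite /tensor_bracket wedgeE. Qed.

Lemma tensor_at_emap (L : fieldType) (iota : {rmorphism K -> L}) xi w :
  tensor_at iota xi w = tensor_mx (emap (mmap iota xi) w).
Proof.
apply/matrixP=> i j; rewrite !mxE tensor_bracketE !df_var.
rewrite -epair_emap emapM !evec_delta; congr (epair _ (_ * _));
by apply/ffunP=> J; rewrite emapE !ebasisE rmorph_nat.
Qed.

Lemma exp_at_eq0_rank (L : fieldType) (iota : {rmorphism K -> L}) xi w m :
  edeg 2 w -> (forall J, mmap iota xi ((w ^+ m) J) = 0) ->
  (\rank (tensor_at iota xi w) < m.*2)%N.
Proof.
move=> dw wm0; rewrite tensor_at_emap; apply: exp_eq0_rank.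
- by move=> p; rewrite (fmorph_pchar iota).
- exact: edeg_emap.
by rewrite -emapX; apply/ffunP=> J; rewrite emapE exterior0; apply: wm0.
Qed.

Lemma tensor_rank_attained w :
  exists xi : 'I_n -> K, \rank (tensor_at idfun xi w) = tensor_rank w.
Proof.
pose P (r : 'I_n.+1) := boolp.asbool (exists xi : 'I_n -> K,
  \rank (tensor_at idfun xi w) = r :> nat).
pose r0 : 'I_n.+1 := inord (\rank (tensor_at idfun (fun=> 0 : K) w)).
have Pr0 : P r0.
  by apply/boolp.asboolP; exists (fun=> 0); rewrite inordK // ltnS rank_leq_row.
rewrite /tensor_rank (bigop.bigmax_eq_arg r0 Pr0).
by case: arg_maxnP => // r /boolp.asboolP.
Qed.

Lemma tensor_rank_index w l : tensor_index w = l -> tensor_rank w = (n - l)%N.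
Proof.
move=> <-; have [xi rk] := tensor_rank_attained w.
by rewrite /tensor_index subKn // -rk rank_leq_row.
Qed.

Lemma half_double_leq m : (m./2.*2 <= m)%N.
Proof. by rewrite -{2}(odd_double_half m) leq_addl. Qed.

(** The rank is [n - l] at some point, and [exp_eq0_rank] applies there. *)
Lemma exp_neq0 w l : edeg 2 w -> tensor_index w = l -> w ^+ (n - l)./2 != 0.
Proof.
move=> dw /tensor_rank_index rkw; apply/eqP=> w0.
have [xi] := tensor_rank_attained w; rewrite rkw => rk.
have w0_at J : mmap idfun xi ((w ^+ (n - l)./2) J) = 0.
  by rewrite w0 exterior0 mmap0.
have := leq_trans (exp_at_eq0_rank (iota := idfun) dw w0_at) (half_double_leq _).
by rewrite rk ltnn.
Qed.

Lemma center_contr w a : edeg 2 w -> in_center w a ->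
  contr (fun i => a^`M(i)) w = 0.
Proof.
move=> dw ca; rewrite (edeg1_evec (@edeg_contr _ _ _ (fun i => a^`M(i)) _ dw)).
apply/ffunP=> J; rewrite exterior0 ffunE big1 // => i _.
by rewrite contrE -df_var -tensor_bracketE ca mul0r.
Qed.

(** The pairing of [u * df a] with any form is, up to the Kostant equality, a pairing with
    the contraction of [w ^+ m] by [df a], which is zero as [a] is central. *)
Lemma center_kostant_wedge w a m (u : exterior A n) : edeg 2 w -> in_center w a ->
  div_omega u = w ^+ m -> u * df a = 0.
Proof.
move=> dw ca eq_u; apply: full_mul_eq0 => v.
rewrite -mulrA -epair_div_omega eq_u -contr_adj; case: m {eq_u} => [|m].
  by rewrite expr0 contr1 epair0l.
by rewrite contr_edeg2_exp // center_contr // mul0r scaler0 epair0l.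
Qed.

(** At the point with ideal [P] the power of [w] vanishes, so the rank drops. *)
Lemma dvd_exp_sing w P q l :
  edeg 2 w -> tensor_index w = l -> prime_pred P -> P q ->
  (forall J, divides q ((w ^+ (n - l)./2) J)) -> sing w P.
Proof.
move=> dw /tensor_rank_index rkw pP Pq dvd.
have [L [iota [xi eqP]]] := prime_pred_point pP.
exists L, iota, xi; split=> //; rewrite rkw.
apply: leq_trans (exp_at_eq0_rank (m := (n - l)./2) dw _) (half_double_leq _).
move=> J; have [c ->] := dvd J; have /eqP q0 := Pq.
by rewrite (rmorphM (mmap iota xi)) [X in _ * X](proj1 (eqP q) Pq) mulr0.
Qed.

(** A common prime factor vanishes at the origin by homogeneity, and a chain of n primes
    through it would consist of singular points. *)
Lemma dim_sing_primitive w l e : edeg 2 w -> tensor_index w = l ->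
    form_homog e (w ^+ (n - l)./2) -> dim_le (sing w) (n%:Z - 2) ->
  forall q, prime_element q -> exists J, ~ divides q ((w ^+ (n - l)./2) J).
Proof.
move=> dw idx hom_w dimS q pq; apply: boolp.contrapT => nex.
have dvd J : divides q ((w ^+ (n - l)./2) J).
  by apply: boolp.contrapT => nd; apply: nex; exists J.
have [J nz_J] := exterior_neq0 (exp_neq0 dw idx).
have q0 := prime_dvd_homog_coef0 pq nz_J (hom_w J) (dvd J).
have [n_gt0 [P [[pP sP] Pq]]] := prime_chain_coef0 pq q0.
have : (n.-1%:Z <= n%:Z - 2)%R.
  apply: (dimS n.-1 P) => [i lei|i lti]; last exact: sP.
  exact: (dvd_exp_sing dw idx (pP i lei) (Pq i lei) dvd).
by rewrite lerBrDr -PoszD lez_nat addn2 prednK // ltnn.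
Qed.

End Tensors.

(** * Linear changes of variables *)
Section LinearAction.
Variables (K : fieldType) (n : nat).
Local Notation A := {mpoly K[n]}.
Implicit Types (M N : 'M[K]_n) (f g : A).

Definition lin_tuple M : n.-tuple A := [tuple \sum_(j < n) M i j *: 'X_j | i < n].

Definition lin_morph M : {rmorphism A -> A} := comp_mpoly (lin_tuple M).

Lemma lin_act_mul M N f : lin_act N (lin_act M f) = lin_act (M *m N) f.
Proof.
rewrite /lin_act comp_mpolyA; congr (_ \mPo _); apply: eq_from_tnth => i.
rewrite !tnth_mktuple rmorph_sum /=.
under eq_bigr do rewrite comp_mpolyZ comp_mpolyX1 tnth_mktuple scaler_sumr.
rewrite exchange_big; apply: eq_bigr => k _ /=.
rewrite mxE scaler_suml; apply: eq_bigr => j _.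
by rewrite scalerA.
Qed.

Lemma lin_act1 f : lin_act 1%:M f = f.
Proof.
rewrite -[RHS]comp_mpoly_id; congr (_ \mPo _); apply: eq_from_tnth => i.
rewrite !tnth_mktuple (bigD1 i) //= mxE eqxx scale1r big1 ?addr0 // => j /negPf.
by rewrite mxE eq_sym => ->; rewrite scale0r.
Qed.

Lemma lin_act_invmx M f : M \in unitmx -> lin_act (invmx M) (lin_act M f) = f.
Proof. by move=> uM; rewrite lin_act_mul mulmxV // lin_act1. Qed.

Lemma lin_actK M f : M \in unitmx -> lin_act M (lin_act (invmx M) f) = f.
Proof. by move=> uM; rewrite lin_act_mul mulVmx // lin_act1. Qed.

Lemma mderiv_lin_act N f k :
  (lin_act N f)^`M(k) = \sum_i lin_act N f^`M(i) * (N i k)%:MP.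
Proof.
rewrite mderiv_comp; apply: eq_bigr => i _; congr (_ * _).
rewrite tnth_mktuple raddf_sum (bigD1 k) //= mderivZ mderiv_var eqxx.
rewrite big1 ?addr0 => [|j /negPf nejk]; last first.
  by rewrite mderivZ mderiv_var nejk scaler0.
by rewrite -mul_mpolyC mulr1.
Qed.

(** Chain rule: the Jacobian determinant is multiplied by that of [N]. *)
Lemma full_lin_act N (s : seq A) :
  (\prod_(f <- s) df (lin_act N f)) setT =
  (\det N)%:MP * lin_act N ((\prod_(f <- s) df f) setT).
Proof.
have eq_df f : df (lin_act N f) =
    evec (fun k => \sum_i (lin_act N f^`M(i)) * (map_mx (@mpolyC n K) N) i k).
  by apply: eq_evec => k; rewrite mderiv_lin_act; apply: eq_bigr => i _;
    rewrite mxE.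
rewrite (eq_bigr _ (fun f _ => eq_df f)).
rewrite (full_prod_mulmx s (fun f i => lin_act N f^`M(i)) (map_mx (@mpolyC n K) N)).
rewrite det_map_mx; congr (_ * _).
rewrite -[RHS](emapE (lin_morph N)) emap_prod; congr ((_ : exterior A n) _).
by apply: eq_bigr => f _; rewrite emap_evec.
Qed.

Lemma prod_df_var (J : {set 'I_n}) : \prod_(i <- enum J) df 'X_i = ebasis A J.
Proof. by rewrite -prod_ebasis_enum; apply: eq_bigr => i _; rewrite df_var. Qed.

(** Test both sides on dx_J and write the coordinates of [J] as images of polynomials
    under the action of [invmx M]. *)
Lemma kostant_lin_act M (w w' : exterior A n) m (s : seq A) :
    M \in unitmx -> edeg 2 w -> edeg 2 w' ->
    (forall f g, tensor_bracket w' f g =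
       lin_act (invmx M) (tensor_bracket w (lin_act M f) (lin_act M g))) ->
    (div_omega (\prod_(f <- s) df f) : exterior A n) = w ^+ m ->
  forall J, (div_omega (\prod_(f <- s) df (lin_act (invmx M) f)) : exterior A n) J =
     (\det (invmx M))%:MP * (w' ^+ m) J.
Proof.
move=> uM dw dw' eq_w' eq_s J; set N := invmx M.
pose g : seq A := [seq 'X_i | i <- enum J]; pose g' := [seq lin_act M f | f <- g].
have prod_g : \prod_(f <- g) df f = ebasis A J by rewrite big_map prod_df_var.
have prod_g' : \prod_(f <- g') df (lin_act N f) = ebasis A J.
  by rewrite -prod_g big_map; apply: eq_bigr => f _; rewrite lin_act_invmx.
rewrite -epair_ebasisr epair_div_omega -prod_g' -big_cat full_lin_act big_cat /=.
rewrite -epair_div_omega eq_s -epair_ebasisr -prod_g big_map; congr (_ * _).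
rewrite -[LHS]/(lin_morph N _).
apply: (@epair_exp_prod_map A A (lin_morph N) n n w w' A
   (fun f i => (lin_act M f)^`M(i)) (fun f i => f^`M(i))) => // f1 f2.
by have := eq_w' f1 f2; rewrite !tensor_bracketE => ->.
Qed.

End LinearAction.

(** * Polynomial families and their limits *)
Section Limits.
Variables (K : fieldType) (charK : [pchar K] =i pred0) (n : nat).
Local Notation A := {mpoly K[n]}.
Implicit Types (p q : {poly A}) (t : K).

Definition at_const t : {rmorphism {poly A} -> A} := horner_eval (t%:MP : A).

Lemma at_constE t p : at_const t p = p.[t%:MP].
Proof. by []. Qed.

(** In characteristic zero the constants 1, 2, 3, ... are infinitely many roots. *)
Lemma poly_eq_at_const p q :
  (forall t, t != 0 -> at_const t p = at_const t q) -> p = q.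
Proof.
move=> eq_pq; apply/eqP; rewrite -subr_eq0; apply/negP=> /negP nz_pq.
pose rs := [seq (k.+1%:R : K)%:MP : A | k <- iota 0 (size (p - q))].
have nat_inj : injective (fun k => k.+1%:R : K).
  have wlog_inj i j : (i <= j)%N -> i.+1%:R = j.+1%:R :> K -> i = j.
    move=> leij /esym/eqP; rewrite -subr_eq0 -natrB // ((pcharf0P K).1 charK) subSS.
    by rewrite subn_eq0 => leji; apply/eqP; rewrite eqn_leq leij.
  by move=> i j eqij; case/orP: (leq_total i j) => /wlog_inj; [|symmetry]; auto.
have := max_poly_roots nz_pq (_ : all (root (p - q)) rs) (_ : uniq rs).
rewrite size_map size_iota ltnn => false_; apply: notF; apply: false_.
  apply/allP=> _ /mapP[k _ ->]; rewrite rootE hornerD hornerN -!at_constE.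
  by rewrite eq_pq ?subrr // ((pcharf0P K).1 charK).
by rewrite map_inj_uniq ?iota_uniq // => i j /(can_inj (@mpolyCK n K))/nat_inj.
Qed.

Lemma is_lim0_poly (u : K -> A) (a : A) : is_lim0 u a ->
  exists p, (forall t, t != 0 -> u t = at_const t p) /\ a = at_const 0 p.
Proof.
case=> m [c [eq_u ->]]; exists (\poly_(k < m.+1) c k); split=> [t nz_t|].
  rewrite eq_u // at_constE horner_poly; apply: eq_bigr => k _.
  by rewrite -mul_mpolyC mulrC rmorphXn.
by rewrite at_constE mpolyC0 horner_coef0 coef_poly.
Qed.

Lemma is_lim0_exterior (u : K -> exterior A n) (a : exterior A n) :
  @is_lim0 K {ffun {set 'I_n} -> A} u a ->
  exists p : exterior {poly A} n,
    (forall t, t != 0 -> u t = emap (at_const t) p) /\ a = emap (at_const 0) p.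
Proof.
case=> m [c [eq_u ->]].
exists [ffun J => \poly_(k < m.+1) c k J]; split=> [t nz_t|].
  rewrite eq_u //; apply/ffunP=> J;
    rewrite sum_ffunE emapE ffunE at_constE horner_poly.
  by apply: eq_bigr => k _; rewrite ffunE -mul_mpolyC mulrC rmorphXn.
by apply/ffunP=> J; rewrite emapE ffunE at_constE mpolyC0 horner_coef0 coef_poly.
Qed.

(** The differential in the variables of [A], with the parameter held constant. *)
Definition poly_df (p : {poly A}) : exterior {poly A} n :=
  evec (fun i => map_poly (mderiv i) p).

Lemma emap_poly_df t p : emap (at_const t) (poly_df p) = df (at_const t p).
Proof.
rewrite emap_evec; apply: eq_evec => i /=; rewrite /horner_eval.
rewrite /map_poly horner_poly horner_coef raddf_sum /=; apply: eq_bigr => k _.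
by rewrite -rmorphXn /= [_ * _%:MP]mulrC [p`_k * _]mulrC mderiv_mulC.
Qed.

Lemma div_omega_emap (R S : comNzRingType) (f : {rmorphism R -> S}) (u : exterior R n) J :
  (div_omega (emap f u) : exterior S n) J = f ((div_omega u : exterior R n) J).
Proof.
rewrite -!epair_ebasisr !epair_div_omega -emapE emapM;
  congr ((_ * _ : exterior S n) _).
by apply/ffunP=> I; rewrite emapE !ebasisE rmorph_nat.
Qed.

End Limits.

(** * Contractions *)
Section Contractions.
Variables (K : fieldType) (charK : [pchar K] =i pred0) (n l : nat).
Local Notation A := {mpoly K[n]}.
Variables (w wlim : exterior A n) (phi : K -> 'M[K]_n).
Hypothesis w_deg : edeg 2 w.
Hypothesis phi_unit : forall t, t != 0 -> phi t \in unitmx.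
Hypothesis w_contr : is_contraction phi w wlim.

Lemma contraction_poly : exists p : exterior {poly A} n,
  [/\ edeg 2 p,
      forall t, t != 0 ->
        edeg 2 (emap (at_const n t) p) /\
        forall f g, tensor_bracket (emap (at_const n t) p) f g =
          lin_act (invmx (phi t)) (tensor_bracket w (lin_act (phi t) f) (lin_act (phi t) g))
    & wlim = emap (at_const n 0) p].
Proof.
have [wt [wt_tensor /is_lim0_exterior[p [eq_wt ->]]]] := w_contr.
exists p; split=> // [J|t nz_t]; last by rewrite -eq_wt //; apply: wt_tensor.
apply: contraNeq => neJ; apply/eqP/(poly_eq_at_const charK) => t nz_t.
have [dwt _] := wt_tensor t nz_t.
rewrite rmorph0 -(emapE (at_const n t)) -eq_wt //.
exact: edeg_eq0 dwt neJ.
Qed.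

Lemma contraction_deg : edeg 2 wlim.
Proof. by have [p [dp _ ->]] := contraction_poly; apply: edeg_emap. Qed.

(** The bracket of the two families is polynomial in [t] and vanishes for [t != 0]. *)
Lemma contraction_center F d Fb : in_center w F ->
  is_highest_component phi F d Fb -> in_center wlim Fb.
Proof.
move=> cF [/is_lim0_poly[q [eq_q ->]] _] b.
have [p [dp eq_p ->]] := contraction_poly.
pose z := epair p (poly_df q * poly_df b%:P).
have eq_z t : at_const n t z =
    tensor_bracket (emap (at_const n t) p) (at_const n t q) b.
  rewrite /z -epair_emap emapM !emap_poly_df tensor_bracketE.
  by rewrite (_ : at_const n t b%:P = b) // at_constE hornerC.
rewrite -eq_z; suffices -> : z = 0 by rewrite rmorph0.
apply: (poly_eq_at_const charK) => t nz_t; rewrite rmorph0 eq_z.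
have [_ ->] := eq_p t nz_t; rewrite -eq_q //.
have -> : lin_act (phi t) (t ^ d *: lin_act (invmx (phi t)) F) = t ^ d *: F.
  by rewrite /lin_act comp_mpolyZ -/(lin_act _ _) -/(lin_act _ _) lin_actK ?phi_unit.
rewrite tensor_bracketE df_scale -scalerAl epairZr -tensor_bracketE cF mulr0.
exact: comp_mpoly0.
Qed.

Variables (F Fb : l.-tuple A) (D : int) (d : 'I_l -> int) (m : nat).
Hypothesis det_phi : forall t : K, t != 0 -> \det (phi t) = t ^ D.
Hypothesis F_kostant : div_omega (total_wedge F) = w ^+ m.
Hypothesis F_comp : forall i : 'I_l,
  is_highest_component phi (tnth F i) (d i) (tnth Fb i).

(** [u] and [v] are the two sides of the Kostant equality for the family, as polynomials
    in the parameter. *)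
Lemma kostant_poly : exists u v : exterior {poly A} n,
  [/\ div_omega (total_wedge Fb) = emap (at_const n 0) u,
      wlim ^+ m = emap (at_const n 0) v
    & forall t J, t != 0 -> at_const n t (u J) =
        (t ^ (\sum_i d i - D))%:MP * at_const n t (v J)].
Proof.
have [p [dp eq_p ->]] := contraction_poly.
have [q eq_q] := boolp.choice (fun i => is_lim0_poly (F_comp i).1).
pose U : exterior {poly A} n := \prod_(i < l) poly_df (q i).
have eq_U t : emap (at_const n t) U = \prod_(i < l) df (at_const n t (q i)).
  by rewrite emap_prod; apply: eq_bigr => i _; rewrite emap_poly_df.
exists (div_omega U), (p ^+ m); split; last 1 first.
- move=> t J nz_t; have [dpt br_t] := eq_p t nz_t.
  rewrite -div_omega_emap eq_U -emapE emapX.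
  have -> : \prod_(i < l) df (at_const n t (q i)) =
      (t ^ (\sum_i d i))%:MP *: \prod_(f <- F) df (lin_act (invmx (phi t)) f).
    rewrite big_tuple.
    have -> : (t ^ (\sum_i d i))%:MP = \prod_(i < l) (t ^ d i)%:MP :> A.
      rewrite -rmorph_prod; congr (_ %:MP).
      by apply: (big_morph (exprz t)) => [x y|]; rewrite ?expfzDr.
    rewrite -scaler_prod; apply: eq_bigr => i _.
    by rewrite -(eq_q i).1 // df_scale.
  rewrite -epair_ebasisr epair_div_omega -scalerAl exteriorZ -epair_div_omega epair_ebasisr.
  rewrite (kostant_lin_act (phi_unit nz_t) w_deg dpt br_t F_kostant).
  by rewrite det_inv det_phi // mulrA -mpolyCM invr_expz -expfzDr.
- apply/ffunP=> J; rewrite emapE -div_omega_emap eq_U;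
  congr ((div_omega _ : exterior A n) J).
  rewrite /total_wedge big_tuple; apply: eq_bigr => i _.
  by rewrite -(eq_q i).2.
by rewrite emapX.
Qed.

End Contractions.

(** * Kostant equality and the theorem *)
Lemma kostantE (K : fieldType) (n l : nat) (F : l.-tuple {mpoly K[n]})
    (w : exterior {mpoly K[n]} n) :
  kostant F w <-> div_omega (total_wedge F) = w ^+ (n - l)./2.
Proof.
rewrite /kostant -wedge_powE big_wedgeE /total_wedge big_tuple.
by [].
Qed.

Lemma div_omega_eq0 (R : comNzRingType) n (u : exterior R n) :
  div_omega u = (0 : exterior R n) -> u = 0.
Proof.
move=> u0; apply: full_mul_eq0 => v.
by rewrite -epair_div_omega u0 epair0l.
Qed.

Lemma int_lt_succ (a b : int) : a < b -> exists k : nat, b - a = k.+1%:Z.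
Proof. by rewrite -subr_gt0; case: (b - a) => // -[|k] // _; exists k. Qed.

Lemma at_const_Xn (K : fieldType) n (t : K) k :
  at_const n t 'X^k = (t ^+ k)%:MP.
Proof. by rewrite at_constE hornerXn rmorphXn. Qed.

Section Kostant.
Variables (K : fieldType) (charK : [pchar K] =i pred0) (n l : nat).
Local Notation A := {mpoly K[n]}.
Variables (w : exterior A n) (F : l.-tuple A).
Hypothesis w_deg : edeg 2 w.
Hypothesis w_index : tensor_index w = l.
Hypothesis F_kostant : div_omega (total_wedge F) = w ^+ (n - l)./2.

Lemma kostant_wedge_neq0 : total_wedge F != 0.
Proof.
apply: contraNneq (exp_neq0 charK w_deg w_index) => F0.
rewrite -F_kostant F0; apply/eqP/ffunP=> J.
by rewrite -epair_ebasisr epair_div_omega mul0r !exterior0.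
Qed.

Lemma kostant_alg_independent : alg_independent F.
Proof.
apply: (nonzero_wedge_alg_independent charK).
by rewrite -(big_tuple _ _ F xpredT (@df K n)); apply: kostant_wedge_neq0.
Qed.

Lemma div_omega_coef (u : exterior A n) J :
  (div_omega u : exterior A n) J = (-1) ^+ inversions (~: J) J * u (~: J).
Proof.
by rewrite -epair_ebasisr epair_div_omega -{1}[J]setCK full_mul_ebasisC setCK.
Qed.

(** Central elements satisfy the equation in [wedge_closed_generated], by
    [center_kostant_wedge].  Up to signs the coefficients of the total wedge are those of
    the power of [w], so [dim_sing_primitive] rules out a common prime factor. *)
Lemma kostant_center_generated : (forall i, in_center w (tnth F i)) ->
    dim_le (sing w) (n%:Z - 2) ->
    (forall i, exists k : nat, tnth F i \is k.-homog) ->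
  generates F (in_center w).
Proof.
move=> F_center dimS F_homog a; split=> [ca|[P ->] b].
  apply: (wedge_closed_generated charK F_homog kostant_wedge_neq0).
    have [e hom_F] := total_wedge_homog F_homog.
    have sgn k (x : A) d : (-1) ^+ k * x \is d.-homog = (x \is d.-homog).
      by rewrite -signr_odd mulr_sign; case: odd; rewrite ?dhomogN.
    have hom_w : form_homog e (w ^+ (n - l)./2).
      by move=> J; rewrite -F_kostant div_omega_coef sgn.
    move=> q /(dim_sing_primitive charK w_deg w_index hom_w dimS)[J ndvd].
    exists (~: J) => -[c eq_c]; apply: ndvd; rewrite -F_kostant div_omega_coef eq_c.
    by exists ((-1) ^+ inversions (~: J) J * c); rewrite mulrA.
  have := center_kostant_wedge w_deg ca F_kostant.
  rewrite (prod_evecC F (fun f i => f^`M(i))) => /exterior_scale_eq0; apply.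
  by rewrite signr_eq0.
rewrite tensor_bracketE df_comp mulr_suml epair_sumr big1 // => j _.
by rewrite -scalerAl epairZr -tensor_bracketE F_center mulr0.
Qed.

End Kostant.

Theorem theorem3p8 (K : fieldType) (charK : [pchar K] =i pred0) (n l : nat)
  (pi pi_lim : ext {mpoly K[n]} n)
  (pi_poisson : is_poisson_tensor pi)
  (pi_index : tensor_index pi = l)
  (phi : K -> 'M[K]_n) (phi_reg : regular_family phi)
  (D : int) (det_phi : forall t : K, t != 0 -> \det (phi t) = t ^ D)
  (pi_contr : is_contraction phi pi pi_lim)
  (pi_lim_index : tensor_index pi_lim = l)
  (F : l.-tuple {mpoly K[n]})
  (F_center : forall i : 'I_l, in_center pi (tnth F i))
  (F_kostant : kostant F pi)
  (d : 'I_l -> int) (Fb : l.-tuple {mpoly K[n]})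
  (F_comp : forall i : 'I_l,
     is_highest_component phi (tnth F i) (d i) (tnth Fb i)) :
  [/\ D <= \sum_(i < l) d i /\
        (D < \sum_(i < l) d i -> alg_dependent Fb),
      \sum_(i < l) d i = D -> alg_independent Fb /\ kostant Fb pi_lim
    & \sum_(i < l) d i = D ->
      dim_le (sing pi_lim) (n%:Z - 2) ->
      (forall i : 'I_l, exists k : nat, tnth Fb i \is k.-homog) ->
      generates Fb (in_center pi_lim)].
Proof.
have pi_deg : edeg 2 (pi : exterior _ n) by case: pi_poisson.
have phi_unit : forall t, t != 0 -> phi t \in unitmx by case: phi_reg.
have lim_deg := contraction_deg charK pi_contr.
have lim_neq0 := exp_neq0 charK lim_deg pi_lim_index.
have [u [v [eq_u eq_v uv]]] := kostant_poly charK pi_deg phi_unit pi_contr det_phi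
  ((kostantE F pi).1 F_kostant) F_comp.
have Fb_center i : in_center pi_lim (tnth Fb i).
  by have := contraction_center charK phi_unit pi_contr (F_center i) (F_comp i).
have Fb_kostant : \sum_(i < l) d i = D ->
    div_omega (total_wedge Fb) = (pi_lim : exterior _ n) ^+ (n - l)./2.
  move=> eqD; rewrite eq_u eq_v; congr emap; apply/ffunP=> J.
  apply: (poly_eq_at_const charK) => t nz_t.
  by rewrite uv // eqD subrr expr0z mul1r.
split; first split.
- rewrite leNgt; apply/negP=> ltD; case/eqP: lim_neq0; rewrite eq_v.
  have [k eq_k] := int_lt_succ ltD.
  apply/ffunP=> J; rewrite emapE exterior0.
  have -> : v J = 'X^(k.+1) * u J.
    apply: (poly_eq_at_const charK) => t nz_t.
    rewrite rmorphM uv // at_const_Xn mulrA -mpolyCM -[t ^+ _]/(t ^ k.+1%:Z) -expfzDr //.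
    by rewrite -eq_k -[\sum_i d i - D]opprB subrr expr0z mul1r.
  by rewrite rmorphM at_const_Xn expr0n mpolyC0 mul0r.
- move=> ltD; apply: (zero_wedge_alg_dependent charK).
  rewrite -(big_tuple _ _ Fb xpredT (@df K n)); apply: div_omega_eq0; rewrite eq_u.
  have [k eq_k] := int_lt_succ ltD.
  apply/ffunP=> J; rewrite emapE exterior0.
  have -> : u J = 'X^(k.+1) * v J.
    apply: (poly_eq_at_const charK) => t nz_t.
    by rewrite rmorphM uv // at_const_Xn eq_k.
  by rewrite rmorphM at_const_Xn expr0n mpolyC0 mul0r.
- move=> /Fb_kostant kosFb; split; last exact/kostantE.
  exact: (kostant_alg_independent charK lim_deg pi_lim_index kosFb).
move=> /Fb_kostant kosFb dimS Fb_homog.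
exact: (kostant_center_generated charK lim_deg pi_lim_index kosFb).
Qed.
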